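(* Let $k,t,n$ be integers with $1\le t\le k-2$ and $n\ge 100\cdot 2^k k^7$, and let $\mathcal F\subseteq\binom{[n]}{k}$ be a nontrivial $t$-intersecting $k$-graph. Then $$\rho(\mathcal F)\le \max\{\rho(\mathcal A_{n,k,t}),\rho(\mathcal H_{n,k,t})\}.$$ Moreover, equality holds if and only if $\mathcal F$ is isomorphic to one of the families $\mathcal A_{n,k,t}$, $\mathcal H_{n,k,t}$ whose spectral radius attains the maximum on the right-hand side. Equivalently: (i) if $\rho(\mathcal A_{n,k,t})\ne\rho(\mathcal H_{n,k,t})$, then equality is attained (up to isomorphism) only by the candidate with the larger spectral radius; (ii) if $\rho(\mathcal A_{n,k,t})=\rho(\mathcal H_{n,k,t})$, then equality is attained by both candidates (and, up to isomorphism, only by them). Furthermore, for each fixed integer $t\ge 1$, the equation $$(t+2)^{x-t-1}(t+1)^{t+1}=(x-t+1)^{x-1},\qquad x>t+1,$$ has a unique real solution $x=\kappa_t$, one has $\kappa_t\notin\mathbb Z$, and the asymptotic comparison of the two candidates as $n\to\infty$ is as follows: $\mathcal A_{n,k,t}$ has larger asymptotic spectral radius than $\mathcal H_{n,k,t}$ for every integer $k$ with $t+2\le k\le\lfloor\kappa_t\rfloor$, whereas $\mathcal H_{n,k,t}$ has larger asymptotic spectral radius than $\mathcal A_{n,k,t}$ for every integer $k\ge\lceil\kappa_t\rceil$.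
   Context: $[n]=\{1,\dots,n\}$, $[a,b]=\{a,a+1,\dots,b\}$, and $\binom{[n]}{k}$ is the family of all $k$-element subsets of $[n]$. A $k$-graph (on $[n]$) is a subfamily $\mathcal F\subseteq\binom{[n]}{k}$. It is $t$-intersecting if $|F\cap F'|\ge t$ for all $F,F'\in\mathcal F$. For a $t$-set $T\subseteq[n]$, the full $k$-uniform $t$-star with center $T$ is $\{F\in\binom{[n]}{k}:T\subseteq F\}$. A $t$-intersecting family is trivial if it is contained in some full $k$-uniform $t$-star, and nontrivial otherwise. Two families on $[n]$ are isomorphic if a permutation of $[n]$ maps one onto the other. The adjacency-tensor spectral radius of $\mathcal G\subseteq\binom{[n]}{k}$ is $$\rho(\mathcal G)=k\max\Big\{\sum_{e\in \mathcal G}\prod_{i\in e}x_i:\ x_i\ge 0,\ \sum_{i=1}^n x_i^k=1\Big\}.$$ The candidate families are $$\mathcal H_{n,k,t}=\Big\{H\in\tbinom{[n]}{k}:[t]\subseteq H,\ H\cap[t+1,k+1]\ne\emptyset\Big\}\cup\{[k+1]\setminus\{j\}:1\le j\le t\},$$ $$\mathcal A_{n,k,t}=\Big\{A\in\tbinom{[n]}{k}:|A\cap[t+2]|\ge t+1\Big\}.$$ For fixed $k,t$, ''$\mathcal A_{n,k,t}$ has larger asymptotic spectral radius than $\mathcal H_{n,k,t}$'' means that $\lim_{n\to\infty}\rho(\mathcal A_{n,k,t})/\rho(\mathcal H_{n,k,t})$ exists and is $>1$; ''$\mathcal H_{n,k,t}$ has larger asymptotic spectral radius than $\mathcal A_{n,k,t}$''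 means that this limit exists and is $<1$. *)

(* Defs.v *)
From mathcomp Require Import all_boot all_order all_fingroup all_algebra.
From mathcomp Require Import all_classical all_reals all_analysis.
Import Order.TTheory GRing.Theory Num.Theory.
Import numFieldNormedType.Exports.

Set Implicit Arguments.
Unset Strict Implicit.
Unset Printing Implicit Defensive.

Local Open Scope ring_scope.

(* The vertex set [n] = {1, ..., n} is 'I_n, where i : 'I_n stands for the
   vertex i.+1; a family of subsets of [n] is a {set {set 'I_n}}. *)

(* {a, ..., b} in the 1-based labels, cut down to [n] when n < b. *)
Definition seg (n a b : nat) : {set 'I_n} := [set i : 'I_n | a <= i.+1 <= b]%N.

Definition kgraph (n k : nat) (F : {set {set 'I_n}}) : Prop :=
  forall e : {set 'I_n}, e \in F -> #|e| = k.

Definition tintersecting (n t : nat) (F : {set {set 'I_n}}) : Prop :=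
  forall e f : {set 'I_n}, e \in F -> f \in F -> (t <= #|e :&: f|)%N.

Definition full_star (n k : nat) (T : {set 'I_n}) : {set {set 'I_n}} :=
  [set e : {set 'I_n} | (#|e| == k) && (T \subset e)].

Definition trivial_family (n k t : nat) (F : {set {set 'I_n}}) : Prop :=
  exists2 T : {set 'I_n}, #|T| = t & F \subset full_star k T.

Definition nontrivial_tintersecting (n k t : nat) (F : {set {set 'I_n}}) :
    Prop :=
  [/\ kgraph k F, tintersecting t F & ~ trivial_family k t F].

Definition isomorphic (n : nat) (F G : {set {set 'I_n}}) : Prop :=
  exists s : {perm 'I_n}, [set s @: e | e : {set 'I_n} in F] = G.

Definition Hfam (n k t : nat) : {set {set 'I_n}} :=
  [set e : {set 'I_n} | [&& #|e| == k, seg n 1 t \subset e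
                          & e :&: seg n t.+1 k.+1 != finset.set0]]
  :|: [set seg n 1 k.+1 :\ j | j in seg n 1 t].

Definition Afam (n k t : nat) : {set {set 'I_n}} :=
  [set e : {set 'I_n} | (#|e| == k) && (t.+1 <= #|e :&: seg n 1 t.+2|)%N].

Definition edge_poly (R : realType) (n : nat) (G : {set {set 'I_n}})
    (x : 'I_n -> R) : R :=
  \sum_(e in G) \prod_(i in e) x i.

Definition unit_weights (R : realType) (n k : nat) : set ('I_n -> R) :=
  [set x : 'I_n -> R | (forall i, 0 <= x i) /\ \sum_i x i ^+ k = 1]%classic.

(* The sup is a maximum, see [rho_max] below. *)
Definition rho (R : realType) (n k : nat) (G : {set {set 'I_n}}) : R :=
  k%:R * sup (edge_poly G @` @unit_weights R n k)%classic.

Lemma rho_max (R : realType) (n k : nat) (G : {set {set 'I_n}}) :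
  (0 < n)%N -> (0 < k)%N ->
  exists x : 'I_n -> R,
    [/\ unit_weights k x, rho R k G = k%:R * edge_poly G x
      & forall y, unit_weights k y -> edge_poly G y <= edge_poly G x].
Proof.
case: n G => [//|n] G _ k0.
pose f (v : 'rV[R]_n.+1) := edge_poly G (v ord0).
pose A := [set v : 'rV[R]_n.+1 | unit_weights k (v ord0)]%classic.
pose B := [set v : 'rV[R]_n.+1 | forall i, `[0 : R, 1]%classic (v ord0 i)]%classic.
pose g (v : 'rV[R]_n.+1) := \sum_i v ord0 i ^+ k.
have cB : compact B.
  apply: (@rV_compact R n.+1 (fun=> `[0 : R, 1]%classic)) => i.
  exact: segment_compact.
have cg : continuous g.
  apply: continuous_big; first exact: add_continuous.
  move=> i _ v; apply: (@cvg_comp _ _ _ (fun w : 'rV[R]_n.+1 => w ord0 i)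
    (fun y => y ^+ k)); [exact: coord_continuous | exact: exprn_continuous].
have cf : continuous f.
  apply: continuous_big; first exact: add_continuous.
  move=> e _; apply: continuous_big; first exact: mul_continuous.
  by move=> i _; exact: coord_continuous.
have AE : A = (B `&` (g @^-1` [set 1]))%classic.
  apply/seteqP; split => v /=.
    move=> [v0 v1]; split => // i; rewrite /= in_itv/= v0/=.
    rewrite -(@ler_pXn2r _ k) ?nnegrE ?ler01// expr1n -v1.
    by rewrite (bigD1 i)//= lerDl sumr_ge0// => j _; rewrite exprn_ge0.
  move=> [v01 v1]; split => // i.
  by have := v01 i; rewrite /= in_itv/= => /andP[].
have cA : compact A.
  rewrite AE; apply: compact_closedI => //.
  apply: preimage_closed => [v _|]; first exact: cg.
  exact: closed_eq.
have A0 : (A !=set0)%classic.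
  exists (\row_i (i == ord0)%:R); split=> [i|]; first by rewrite mxE.
  rewrite (bigD1 ord0)//= mxE eqxx expr1n big1 ?addr0// => i i0.
  by rewrite mxE (negbTE i0) expr0n gtn_eqF.
have cfA : {within A, continuous f}%classic by exact: continuous_subspaceT.
have [c cA' fc] := EVT_max_rV A0 cA cfA.
have mx y : unit_weights k y -> edge_poly G y <= edge_poly G (c ord0).
  move=> yk.
  pose w : 'rV[R]_n.+1 := \row_i y i.
  have wE : w ord0 = y by apply/funext => i; rewrite mxE.
  have : w \in A by rewrite inE /A /= wE.
  by move=> /fc; rewrite /f wE.
move: cA'; rewrite inE => cA'.
exists (c ord0); split => //.
rewrite /rho; congr (_ * _); apply/eqP; rewrite eq_le; apply/andP; split.
  apply: ge_sup; first by exists (edge_poly G (c ord0)), (c ord0).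
  by move=> _ [y yk <-]; exact: mx.
apply: ub_le_sup; last by exists (c ord0).
by exists (edge_poly G (c ord0)) => _ [y yk <-]; exact: mx.
Qed.

Definition kappa_equation (R : realType) (t : nat) (x : R) : Prop :=
  (t + 2)%:R `^ (x - t%:R - 1) * (t + 1)%:R ^+ (t + 1)
  = (x - t%:R + 1) `^ (x - 1).

Definition asymptotic_ratio (R : realType) (k t : nat) (l : R) : Prop :=
  (rho R k (Afam n k t) / rho R k (Hfam n k t) @[n --> \oo] --> l)%classic.

(* Main.v *)
Require Import Defs.
From mathcomp Require Import all_boot all_order all_fingroup all_algebra.
From mathcomp Require Import all_classical all_reals all_analysis.
From mathcomp Require Import ring lra zify.
Import Order.TTheory GRing.Theory Num.Theory.
Import numFieldNormedType.Exports.

(** Upper bounds on spectral radii come from the Collatz-Wielandt principle: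
    weights that satisfy the eigenvalue inequality at every vertex bound the
    polynomial of the family by AM-GM on each edge. Applied to families of edges
    with a prescribed trace on a small core, it gives the exact value, so that
    all estimates are in units of n^((1-1/k)(k-t-1)), and the edges containing
    one of boundedly many (t+2)-sets contribute a lower order term.

    A maximal nontrivial t-intersecting family is studied through its
    (t+1)-sets meeting every edge in at least t elements. These sets pairwise
    meet in t elements. If they have no common t-subset, the family lies in a
    copy of A. If they are S + v for v in V, then |V| <= k-t+1, with equality
    only for subfamilies of a copy of H. Otherwise every edge contains S and
    exactly one element of V, where |V| <= k-t, or one of at most 2^k k^2 sets
    of size t+2; such a family is beaten by H, as |V|^(1-1/k) is smaller than
    (k-t+1)^(1-1/k) by a margin that the lower order terms cannot reach.

    The k-th power of the limit ratio is the quotient of the two sides of the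
    equation of kappa at x = k. Its logarithm is positive up to 2t+1 and strictly
    decreasing from there on. *)

(** The two candidates are never compared with each other at finite n: which one wins depends on k
    and t, so every other family only has to lose to the maximum. A maximal family that fits into no
    copy of a candidate loses to H, even where A is the larger candidate. Passing to a maximal
    family yields only an inclusion in a copy of a candidate; the equality case is recovered by
    strict monotonicity of [rho] under inclusion ([rho_strict]), which requires no value of [rho].

    The threshold on n comes from one inequality, [star_gap]. The leading coefficients of H and of a
    star with k - t petals differ by at least 1/4, and up to 2^k k^2 sets of size t + 2, each
    costing at most k / n^(1-1/k), must stay below that. It suffices that n^(1-1/k) >= 8 * 2^k k^4,
    and raising this to the power k / (k - 1) <= 3/2 leads to n >= 100 * 2^k k^7. *)

Set Implicit Arguments.
Unset Strict Implicit.
Unset Printing Implicit Defensive.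

Local Open Scope ring_scope.

(** * Roots *)

Section Root.
Context {R : realType}.
Implicit Types (k : nat) (x y : R).

Definition rt k x : R := x `^ k%:R^-1.
(** This is x^(1-1/k). It is the growth of a star in its number x of petals and, at x = n, the order
    of the contribution of one free vertex of an edge. *)
Definition rtq k x : R := x / rt k x.

Lemma rt_ge0 k x : 0 <= rt k x. Proof. exact: powR_ge0. Qed.

Lemma rt_gt0 k x : 0 < x -> 0 < rt k x. Proof. exact: powR_gt0. Qed.

Lemma rtX k x : (0 < k)%N -> 0 <= x -> rt k x ^+ k = x.
Proof.
move=> k0 x0; rewrite -powR_mulrn ?rt_ge0// /rt -powRrM mulVf ?powRr1//.
by rewrite pnatr_eq0 -lt0n.
Qed.

Lemma rtM k x y : 0 <= x -> 0 <= y -> rt k (x * y) = rt k x * rt k y.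
Proof. exact: powRM. Qed.

Lemma rt1 k : rt k 1 = 1. Proof. by rewrite /rt powR1. Qed.

Lemma ler_rt k x y : 0 <= x -> x <= y -> rt k x <= rt k y.
Proof.
move=> x0 xy; apply: ge0_ler_powR => //; rewrite ?nnegrE ?invr_ge0 ?ler0n//.
exact: le_trans xy.
Qed.

Lemma rtq_ge0 k x : 0 <= x -> 0 <= rtq k x.
Proof. by move=> x0; rewrite divr_ge0 ?rt_ge0. Qed.

Lemma rtq_gt0 k x : 0 < x -> 0 < rtq k x.
Proof. by move=> x0; rewrite divr_gt0 ?rt_gt0. Qed.

Lemma rtqX k x : (0 < k)%N -> 0 < x -> rtq k x ^+ k = x ^+ k.-1.
Proof.
case: k => // k _ x0.
by rewrite exprMn exprVn rtX ?ltW// exprSr mulfK ?gt_eqF.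
Qed.

Lemma ler_rtq k x y : (0 < k)%N -> 0 <= x -> x <= y -> rtq k x <= rtq k y.
Proof.
move=> k0; rewrite le_eqVlt => /predU1P[<-|x0] xy.
  by rewrite {1}/rtq mul0r rtq_ge0.
have y0 : 0 < y by exact: lt_le_trans xy.
rewrite -(@ler_pXn2r _ k) ?nnegrE ?rtq_ge0 ?(ltW x0) ?(ltW y0)// !rtqX//.
by rewrite lerXn2r ?nnegrE ?(ltW x0) ?(ltW y0).
Qed.

(* Clearing denominators, this is Bernoulli's inequality
   1 + k / (2 p) <= (1 + 1 / (2 p)) ^ k. *)
Lemma rtq_gap k (p : nat) : (1 < k)%N -> (0 < p)%N ->
  rtq k p%:R <= rtq k p.+1%:R - (2 * rt k p.+1%:R)^-1.
Proof.
move=> k1 p0; have k0 : (0 < k)%N by exact: ltnW.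
have P0 : 0 < p%:R :> R by rewrite ltr0n.
have P1 : 0 < p.+1%:R :> R by rewrite ltr0n.
rewrite /rtq invfM -mulrBl ler_pdivlMr ?rt_gt0// mulrAC ler_pdivrMr ?rt_gt0//.
have h0 : 0 < p.+1%:R - 2^-1 :> R.
  by have : 1 <= p.+1%:R :> R; [rewrite ler1n|lra].
rewrite -(@ler_pXn2r _ k) ?nnegrE ?mulr_ge0 ?rt_ge0 ?(ltW P0) ?(ltW h0)//.
rewrite !exprMn !rtX ?(ltW P0) ?(ltW P1)//.
have -> : p.+1%:R - 2^-1 = p%:R * (1 + (2 * p%:R)^-1) :> R.
  by rewrite -natr1; field; rewrite gt_eqF.
rewrite exprMn -mulrA ler_pM2l ?exprn_gt0//.
rewrite mulrC -ler_pdivrMl//.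
have : 1 + k%:R * (2 * p%:R)^-1 <= (1 + (2 * p%:R)^-1) ^+ k :> R.
  have u0 : 0 <= (2 * p%:R)^-1 :> R by rewrite invr_ge0 mulr_ge0 ?ltW.
  elim: (k) => [|j IH]; first by rewrite mul0r addr0 expr0.
  rewrite exprS (le_trans _ (ler_wpM2l _ IH)) ?addr_ge0//.
  rewrite -natr1; move: u0; set u := (2 * _)^-1 => u0.
  have : 0 <= j%:R * u * u by rewrite !mulr_ge0.
  lra.
apply: le_trans.
(* What is left is 1 / p <= k / (2 p), that is k >= 2. *)
rewrite -natr1 mulrDr mulVf ?gt_eqF// mulr1 lerD2l.
by rewrite invfM mulrA ler_pMl ?invr_gt0// ler_pdivlMr// mul1r ler_nat.
Qed.

End Root.

(** * Bounds on the spectral radius *)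

Section SpectralRadius.
Context {R : realType} {n : nat}.
Implicit Types (k : nat) (F G : {set {set 'I_n}}) (x y : 'I_n -> R).

Lemma edge_poly_ge0 G x : (forall i, 0 <= x i) -> 0 <= edge_poly G x.
Proof. by move=> x0; apply: sumr_ge0 => e _; apply: prodr_ge0. Qed.

Lemma edge_polyS F G x : (forall i, 0 <= x i) -> F \subset G ->
  edge_poly F x <= edge_poly G x.
Proof.
move=> x0 /fintype.subsetP FG; rewrite /edge_poly [leRHS](bigID (mem F))/=.
rewrite (eq_bigl (fun e => (e \in G) && (e \in F))); last first.
  by move=> e; case: (boolP (e \in F)) => [/FG ->|]; rewrite ?andbF.
by rewrite lerDl; apply: sumr_ge0 => e _; apply: prodr_ge0.
Qed.

Lemma edge_poly_setU F G x : (forall i, 0 <= x i) ->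
  edge_poly (F :|: G) x <= edge_poly F x + edge_poly G x.
Proof.
move=> x0; rewrite /edge_poly (bigID (mem F))/=; apply: lerD.
  rewrite [X in X <= _](_ : _ = \sum_(e in F) \prod_(i in e) x i)//.
  by apply: eq_bigl => e; rewrite finset.in_setU; case: (e \in F); rewrite ?andbF.
rewrite [leRHS](bigID (mem F))/= [X in X <= _](_ : _ =
  \sum_(e in G | e \notin F) \prod_(i in e) x i); last first.
  by apply: eq_bigl => e; rewrite finset.in_setU; case: (e \in F); rewrite ?andbF.
by rewrite lerDr; apply: sumr_ge0 => e _; apply: prodr_ge0.
Qed.

(** Normalising the k-th powers to sum k absorbs the factor k of [rho]: rescaling to sum 1 divides
    the product of every edge by k. *)
Lemma rho_ge k G y : (0 < k)%N -> (forall i, 0 <= y i) ->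
  \sum_i y i ^+ k = k%:R -> kgraph k G -> edge_poly G y <= rho R k G.
Proof.
move=> k0 y0 yk Gk.
have n0 : (0 < n)%N.
  case: n G y y0 yk Gk => // G y _ /eqP; rewrite big_ord0 eq_sym pnatr_eq0.
  by move=> /eqP k_eq0; rewrite k_eq0 in k0.
have [x [_ -> xmax]] := rho_max R G n0 k0.
have k0R : 0 < k%:R :> R by rewrite ltr0n.
have r0 : 0 < rt k k%:R :> R by apply: rt_gt0.
pose z i := y i / rt k k%:R.
have zE : k%:R * edge_poly G z = edge_poly G y.
  rewrite /edge_poly big_distrr/=; apply: eq_bigr => e /Gk ek.
  rewrite big_split/= prodr_const ek exprVn rtX ?ltW//.
  by rewrite mulrCA mulfV ?mulr1// gt_eqF.
rewrite -zE ler_pM2l//; apply: xmax; split=> [i|].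
  by rewrite divr_ge0// ltW.
under eq_bigr => i _ do rewrite exprMn exprVn rtX ?(ltW k0R)//.
by rewrite -big_distrl/= yk mulfV ?gt_eqF.
Qed.

Lemma rho_le k G (c : R) : (0 < n)%N -> (0 < k)%N ->
  (forall x, (forall i, 0 <= x i) -> \sum_i x i ^+ k = 1 ->
     k%:R * edge_poly G x <= c) ->
  rho R k G <= c.
Proof. by move=> n0 k0 h; have [x [[x0 xk] -> _]] := rho_max R G n0 k0; exact: h. Qed.

Lemma rho_lt k G (c : R) : (0 < n)%N -> (0 < k)%N ->
  (forall x, (forall i, 0 <= x i) -> \sum_i x i ^+ k = 1 ->
     k%:R * edge_poly G x < c) ->
  rho R k G < c.
Proof. by move=> n0 k0 h; have [x [[x0 xk] -> _]] := rho_max R G n0 k0; exact: h. Qed.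

Lemma rhoS k F G : (0 < n)%N -> (0 < k)%N -> F \subset G ->
  rho R k F <= rho R k G.
Proof.
move=> n0 k0 FG; have [x [_ -> xmax]] := rho_max R G n0 k0.
apply: rho_le => // y y0 yk; rewrite ler_pM2l ?ltr0n//.
exact: le_trans (edge_polyS y0 FG) (xmax _ _).
Qed.

Lemma AGM_prod k (e : {set 'I_n}) y : (0 < k)%N -> #|e| = k ->
  (forall i, 0 <= y i) ->
  k%:R * \prod_(i in e) y i <= \sum_(i in e) y i ^+ k.
Proof.
move=> k0 ek y0.
have [+ _] : \prod_(i in e) y i ^+ k <= ((\sum_(i in e) y i ^+ k) / #|e|%:R) ^+ #|e|
    ?= iff [forall i in e, forall j in e, y i ^+ k == y j ^+ k].
  by apply: leif_AGM => i _; rewrite exprn_ge0.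
rewrite ek prodrXl ler_pXn2r//; last 2 first.
- by rewrite nnegrE prodr_ge0.
- by rewrite nnegrE divr_ge0// sumr_ge0// => i _; rewrite exprn_ge0.
by rewrite ler_pdivlMr ?ltr0n// mulrC.
Qed.

(* Collatz-Wielandt: AM-GM on each edge, in the variables x i / a i. *)
Lemma edge_poly_le_CW k G (a : 'I_n -> R) (mu : R) x : (0 < k)%N ->
  kgraph k G -> (forall i, 0 < a i) -> (forall i, 0 <= x i) ->
  (forall i, \sum_(e in G | i \in e) \prod_(j in e) a j <= mu * a i ^+ k) ->
  k%:R * edge_poly G x <= mu * \sum_i x i ^+ k.
Proof.
move=> k0 Gk a0 x0 amu.
pose y i := x i / a i.
have y0 i : 0 <= y i by rewrite divr_ge0// ltW.
apply: (@le_trans _ _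
  (\sum_(e in G) \prod_(j in e) a j * \sum_(i in e) y i ^+ k)).
  rewrite /edge_poly big_distrr/=; apply: ler_sum => e eG.
  have -> : \prod_(i in e) x i = \prod_(j in e) a j * \prod_(i in e) y i.
    rewrite -big_split/=; apply: eq_bigr => i _.
    by rewrite /y mulrCA mulfV ?mulr1// gt_eqF.
  rewrite mulrCA ler_wpM2l ?AGM_prod ?Gk//.
  by apply: prodr_ge0 => j _; exact: ltW.
under eq_bigr => e _ do rewrite big_distrr/=.
rewrite (exchange_big_dep predT)//= big_distrr/=; apply: ler_sum => i _.
rewrite -big_distrl/=.
have -> : x i ^+ k = a i ^+ k * y i ^+ k.
  by rewrite -exprMn /y mulrCA mulfV ?mulr1// gt_eqF.
by rewrite mulrA ler_wpM2r ?exprn_ge0.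
Qed.

Lemma imset_perm_edge_poly (s : {perm 'I_n}) G x :
  edge_poly [set s @: e | e : {set 'I_n} in G] x = edge_poly G (x \o s).
Proof.
rewrite /edge_poly big_imset/=; last first.
  by move=> e f _ _; apply: imset_inj; exact: perm_inj.
apply: eq_bigr => e _; rewrite big_imset//= => i j _ _; exact: perm_inj.
Qed.

Lemma rho_isomorphic k F G : (0 < n)%N -> (0 < k)%N -> isomorphic F G ->
  rho R k F = rho R k G.
Proof.
move=> n0 k0 [s <-].
have unitP (u : {perm 'I_n}) x : \sum_i (x \o u) i ^+ k = \sum_i x i ^+ k.
  by rewrite [RHS](reindex_inj (@perm_inj _ u)).
have [x [[x0 xk] -> xmax]] := rho_max R F n0 k0.
have [y [[y0 yk] -> ymax]] := rho_max R [set s @: e | e : {set 'I_n} in F] n0 k0.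
congr (_ * _); apply: le_anti; apply/andP; split.
  have -> : x = (x \o s^-1%g) \o s by apply/funext => i /=; rewrite permK.
  rewrite -imset_perm_edge_poly; apply: ymax; split=> [i|]; first exact: x0.
  by rewrite unitP.
rewrite imset_perm_edge_poly; apply: xmax; split=> [i|]; first exact: y0.
by rewrite unitP.
Qed.

End SpectralRadius.

(** * Families with prescribed traces on a core *)

Section CoreFamily.
Import mathcomp.boot.fintype mathcomp.boot.finset.
Context {n : nat}.
Implicit Types (k u m : nat) (C : {set 'I_n}) (BB : {set {set 'I_n}}).

Definition core_family k C BB : {set {set 'I_n}} :=
  [set e : {set 'I_n} | (#|e| == k) && (e :&: C \in BB)].

Definition degree BB (i : 'I_n) : nat := #|[set B : {set 'I_n} in BB | i \in B]|.

Definition uniform_on u C BB : Prop :=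
  forall B : {set 'I_n}, B \in BB -> B \subset C /\ #|B| = u.

Lemma kgraph_core_family k C BB : kgraph k (core_family k C BB).
Proof. by move=> e; rewrite inE => /andP[/eqP]. Qed.

Lemma card_trace k C (D : {set 'I_n}) : D \subset C -> (#|D| <= k)%N ->
  #|[set e : {set 'I_n} | (#|e| == k) && (e :&: C == D)]|
  = 'C(n - #|C|, k - #|D|).
Proof.
move=> DC Dk.
have -> : (n - #|C| = #|~: C|)%N by have := cardsC C; rewrite card_ord; lia.
rewrite -cards_draws.
have AC0 (A : {set 'I_n}) : A \subset ~: C -> A :&: C = set0.
  by rewrite -disjoints_subset -setI_eq0 => /eqP.
have AD0 (A : {set 'I_n}) : A \subset ~: C -> A :&: D = set0.
  by move=> /AC0 A0; apply/eqP; rewrite -subset0 -A0 setIS.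
rewrite -[RHS](@card_in_imset _ _ (fun A => A :|: D)); last first.
  move=> A1 A2; rewrite !inE => /andP[A1C _] /andP[A2C _] /(congr1 (fun A => A :&: ~: C)).
  have D0 : D :&: ~: C = set0.
    by apply/eqP; rewrite setI_eq0 disjoints_subset setCK.
  by rewrite !setIUl D0 !setU0 (setIidPl A1C) (setIidPl A2C).
apply: eq_card => e; rewrite inE; apply/idP/imsetP => [/andP[/eqP ek /eqP eD]|].
  exists (e :\: C); last by rewrite -eD setUC setID.
  rewrite !inE setDE subsetIr/= -setDE -eD.
  by rewrite cardsD ek.
move=> [A]; rewrite inE => /andP[AC /eqP Ak] ->.
rewrite cardsU (AD0 _ AC) cards0 subn0 Ak subnK// eqxx/=.
by rewrite setIUl (AC0 _ AC) set0U (setIidPl DC).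
Qed.

Lemma card_core_family k u C BB : uniform_on u C BB -> (u <= k)%N ->
  #|core_family k C BB| = (#|BB| * 'C(n - #|C|, k - u))%N.
Proof.
move=> BBu uk; rewrite -sum1_card.
rewrite (partition_big (fun e => e :&: C) (mem BB))/=; last first.
  by move=> e; rewrite inE => /andP[].
rewrite -sum_nat_const; apply: eq_bigr => B BBB.
have [BC Bu] := BBu _ BBB.
rewrite -Bu -card_trace ?Bu// -sum1_card; apply: eq_bigl => e; rewrite !inE.
by case: eqP => //= _; case: eqP => [->|]; rewrite ?BBB ?andbF.
Qed.

Lemma card_core_family_in k u C BB i : uniform_on u C BB -> (u <= k)%N ->
  i \in C -> #|[set e in core_family k C BB | i \in e]|
             = (degree BB i * 'C(n - #|C|, k - u))%N.
Proof.
move=> BBu uk iC; rewrite /degree -(@card_core_family k u C)//.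
  apply: eq_card => e; rewrite !inE iC andbT.
  by rewrite -andbA.
by move=> B; rewrite inE => /andP[/BBu].
Qed.

(** Moving i into the core turns these edges into a core family again, with core [i |: C], traces
    [i |: B] and one free vertex fewer. *)
Lemma card_core_family_notin k u C BB i : uniform_on u C BB -> (u < k)%N ->
  i \notin C -> #|[set e in core_family k C BB | i \in e]|
             = (#|BB| * 'C((n - #|C|).-1, (k - u).-1))%N.
Proof.
move=> BBu uk iC.
have iB (B : {set 'I_n}) : B \in BB -> i \notin B.
  by move=> /BBu[/subsetP BC _]; apply: contra iC; exact: BC.
have <- : #|[set i |: B | B : {set 'I_n} in BB]| = #|BB|.
  rewrite card_in_imset// => B1 B2 /iB iB1 /iB iB2 /(congr1 (fun A => A :\ i)).
  by rewrite !setU1K.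
have -> : ((n - #|C|).-1 = n - #|i |: C|)%N by rewrite cardsU1 iC; lia.
have -> : ((k - u).-1 = k - u.+1)%N by lia.
rewrite -(@card_core_family k u.+1 (i |: C))//; last first.
  move=> _ /imsetP[B BBB ->]; have [BC Bu] := BBu _ BBB.
  by rewrite setUS// cardsU1 iB// Bu.
apply: eq_card => e; rewrite !inE -andbA; congr (_ && _).
apply/andP/imsetP => [[eB ie]|[B BBB]].
  by exists (e :&: C) => //; apply/setP => j; rewrite !inE; case: eqP => [->|_]; rewrite ?ie.
move=> eB; have ie : i \in e.
  by have := setU11 i B; rewrite -eB inE => /andP[].
split=> //; suff -> : e :&: C = B by [].
apply/setP => j; have := congr1 (fun A : {set 'I_n} => j \in A) eB.
rewrite !inE; case: eqP => [->|//].
by rewrite (negbTE iC) (negbTE (iB _ BBB)) andbF.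
Qed.

End CoreFamily.

Section CoreWeights.
Context {R : realType} {n : nat}.
Implicit Types (k u m : nat) (C : {set 'I_n}) (BB : {set {set 'I_n}}).

Definition core_weight C (a : 'I_n -> R) (zeta : R) (i : 'I_n) : R :=
  if i \in C then a i else zeta.

Lemma prod_core_weight k u C BB a (zeta alpha : R) (e : {set 'I_n}) :
  uniform_on u C BB -> (forall B, B \in BB -> \prod_(i in B) a i = alpha) ->
  e \in core_family k C BB ->
  \prod_(i in e) core_weight C a zeta i = alpha * zeta ^+ (k - u).
Proof.
move=> BBu BBa; rewrite inE => /andP[/eqP ek eBB].
rewrite (bigID (mem C))/=; congr (_ * _).
  rewrite -(BBa _ eBB); apply: eq_big => [i|i /andP[_ iC]].
    by rewrite finset.in_setI.
  by rewrite /core_weight iC.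
rewrite (eq_bigr (fun=> zeta)) => [|i /andP[_ /negbTE iC]]; last first.
  by rewrite /core_weight iC.
have [_ eu] := BBu _ eBB.
rewrite -ek -eu -finset.cardsD -(@prodr_const _ _ (mem (e :\: C)%SET)).
by apply: eq_bigl => i; rewrite finset.in_setD andbC.
Qed.

(** All edges have the same product of weights, so the Collatz-Wielandt condition only counts edges.
    At i in C it becomes deg(i) <= |BB| a_i^k. Outside C, with N = n - |C| and m = k - u, the
    identity N C(N-1, m-1) = m C(N, m) turns it into m <= N zeta^k. Asking only for inequalities
    leaves room for a zeta above the value given by the eigenvector. *)
Lemma core_family_upper k u C BB a (zeta alpha : R) (x : 'I_n -> R) :
  (0 < k)%N -> (u <= k)%N -> uniform_on u C BB ->
  (forall i, i \in C -> 0 < a i) -> 0 < zeta ->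
  (forall B, B \in BB -> \prod_(i in B) a i = alpha) ->
  (forall i, i \in C -> (degree BB i)%:R <= #|BB|%:R * a i ^+ k) ->
  (k - u)%:R <= (n - #|C|)%:R * zeta ^+ k ->
  (forall i, 0 <= x i) ->
  k%:R * edge_poly (core_family k C BB) x
  <= #|BB|%:R * alpha * 'C(n - #|C|, k - u)%:R * zeta ^+ (k - u)
     * \sum_i x i ^+ k.
Proof.
move=> k0 uk BBu a0 z0 BBa adeg zdeg x0.
have [->|[B0 B0BB]] := finset.set_0Vmem BB.
  rewrite finset.cards0 !mul0r /edge_poly big1 ?mulr0// => e.
  by rewrite !finset.inE andbF.
have alpha0 : 0 <= alpha.
  rewrite -(BBa _ B0BB); apply: prodr_ge0 => i iB0; apply/ltW/a0.
  by have [/fintype.subsetP ->] := BBu _ B0BB.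
pose w := core_weight C a zeta.
have w0 i : 0 < w i by rewrite /w /core_weight; case: ifP => // /a0.
apply: (edge_poly_le_CW k0 _ w0) => //; first exact: kgraph_core_family.
move=> i; under eq_bigr => e /andP[eC _] do
  rewrite (@prod_core_weight k u C BB a zeta alpha)//.
rewrite sumr_const -[leLHS]mulr_natr.
have -> : #|[pred e in core_family k C BB | i \in e]|
    = #|[set e in core_family k C BB | i \in e]%SET|.
  by apply: eq_card => e; rewrite [RHS]finset.inE.
rewrite /w /core_weight; case: ifPn => iC.
  rewrite (card_core_family_in BBu)//. rewrite natrM.
  rewrite (_ : _ * (_ * _) = (degree BB i)%:R *
    (alpha * 'C(n - #|C|, k - u)%:R * zeta ^+ (k - u))); last by ring.
  rewrite (_ : _ * a i ^+ k = #|BB|%:R * a i ^+ k *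
    (alpha * 'C(n - #|C|, k - u)%:R * zeta ^+ (k - u))); last by ring.
  by rewrite ler_wpM2r ?adeg// !mulr_ge0// exprn_ge0// ltW.
have [uk'|] := ltnP u k; last first.
  (* For u = k every edge lies inside C, so no edge contains i. *)
  move=> ku; have {ku uk} ku : k = u by apply/eqP; rewrite eqn_leq ku uk.
  rewrite (_ : [set e in _ | _]%SET = finset.set0); last first.
    apply/setP => e; rewrite !finset.inE; apply/negP => /andP[/andP[/eqP ek]].
    move=> /BBu[_ eC] ie; move: iC; apply/negP; rewrite negbK.
    have /eqP eCe : e :&: C == e by rewrite eqEcard finset.subsetIl eC ek ku leqnn.
    by move: ie; rewrite -eCe finset.inE => /andP[].
  rewrite finset.cards0 mulr0 !mulr_ge0 ?exprn_ge0 ?(ltW z0)//.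
rewrite (card_core_family_notin BBu)// natrM.
have nC0 : (0 < n - #|C|)%N.
  have := max_card (mem (i |: C)%SET).
  by rewrite finset.cardsU1 iC card_ord; lia.
have binE : (n - #|C|)%:R * 'C((n - #|C|).-1, (k - u).-1)%:R
    = (k - u)%:R * 'C(n - #|C|, k - u)%:R :> R.
  rewrite -!natrM; congr (_%:R).
  have -> : (k - u = (k - u).-1.+1)%N by rewrite prednK// subn_gt0.
  by rewrite -mul_bin_diag.
rewrite -(@ler_pM2l _ (n - #|C|)%:R) ?ltr0n//.
set c := #|BB|%:R; set z := zeta ^+ (k - u).
rewrite [leLHS](_ : _ = c * alpha * z * ((n - #|C|)%:R *
  'C((n - #|C|).-1, (k - u).-1)%:R)); last by ring.
rewrite binE [leLHS](_ : _ = c * alpha * 'C(n - #|C|, k - u)%:R * z *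
  (k - u)%:R); last by ring.
rewrite [leRHS](_ : _ = c * alpha * 'C(n - #|C|, k - u)%:R * z *
  ((n - #|C|)%:R * zeta ^+ k)); last by ring.
by rewrite ler_wpM2l// !mulr_ge0// exprn_ge0// ltW.
Qed.

(** The same weights serve as a test vector: their k-th powers sum to u on the core and to k - u
    outside it, which is the normalisation of [rho_ge]. *)
Lemma core_family_lower k u C BB a (zeta alpha : R) :
  (0 < k)%N -> (u <= k)%N -> uniform_on u C BB ->
  (forall i, i \in C -> 0 <= a i) -> 0 <= zeta ->
  (forall B, B \in BB -> \prod_(i in B) a i = alpha) ->
  \sum_(i in C) a i ^+ k = u%:R ->
  (n - #|C|)%:R * zeta ^+ k = (k - u)%:R ->
  #|BB|%:R * alpha * 'C(n - #|C|, k - u)%:R * zeta ^+ (k - u)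
  <= rho R k (core_family k C BB).
Proof.
move=> k0 uk BBu a0 z0 BBa aC zC.
pose w := core_weight C a zeta.
have w0 i : 0 <= w i by rewrite /w /core_weight; case: ifP => // /a0.
apply: le_trans (rho_ge k0 w0 _ (@kgraph_core_family _ _ _ _)).
  rewrite /edge_poly (eq_bigr (fun=> alpha * zeta ^+ (k - u))); last first.
    by move=> e eC; rewrite (@prod_core_weight k u C BB a zeta alpha).
  rewrite sumr_const (card_core_family BBu)// -[leRHS]mulr_natr natrM.
  by rewrite le_eqVlt; apply/orP; left; apply/eqP; ring.
rewrite (bigID (mem C))/= -[in RHS](subnKC uk) natrD; congr (_ + _).
  by rewrite -aC; apply: eq_bigr => i iC; rewrite /w /core_weight iC.
rewrite (eq_bigr (fun=> zeta ^+ k)) => [|i /negbTE iC]; last first.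
  by rewrite /w /core_weight iC.
rewrite sumr_const -[LHS]mulr_natl -zC; congr (_%:R * _).
rewrite [LHS](@eq_card _ _ (~: C)%SET) => [|i]; last by rewrite finset.in_setC.
by have := finset.cardsC C; rewrite card_ord; lia.
Qed.

End CoreWeights.

(** * The common unit of the estimates *)

Section Gauge.
Context {R : realType}.
Implicit Types (k m w N n : nat).

Lemma rtV k (x : R) : 0 < x -> rt k x^-1 = (rt k x)^-1.
Proof.
move=> x0; have r0 := rt_gt0 k x0.
apply: (@mulfI _ (rt k x)); rewrite ?mulfV ?gt_eqF//.
by rewrite -rtM ?invr_ge0 ?(ltW x0)// mulfV ?gt_eqF// rt1.
Qed.

Lemma rt_ge1 k (x : R) : 1 <= x -> 1 <= rt k x.
Proof. by move=> x1; rewrite -(rt1 k) ler_rt. Qed.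

Lemma ffact_leX N m : (N ^_ m <= N ^ m)%N.
Proof.
elim: m => [|m IH]; first by rewrite ffactn0.
by rewrite ffactnSr expnSr leq_mul// leq_subr.
Qed.

Lemma leX_ffact N m : ((N - m) ^ m <= N ^_ m)%N.
Proof.
suff H j : (j <= m)%N -> ((N - m) ^ j <= N ^_ j)%N by exact: H.
elim: j => [|j IH] jm; first by rewrite ffactn0.
by rewrite ffactnSr expnSr leq_mul ?IH ?leq_sub2l// ltnW.
Qed.

(* The common unit of all estimates: it bounds 'C(N, m) * z ^ m when
   z ^ k = w / N and N <= n, and is asymptotic to it when n - N is bounded. *)
Definition gauge k w m n : R := (rt k w%:R * rtq k n%:R) ^+ m / m`!%:R.

Lemma gauge_gt0 k w m n : (0 < w)%N -> (0 < n)%N -> 0 < gauge k w m n.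
Proof.
move=> w0 n0; rewrite divr_gt0 ?ltr0n ?fact_gt0// exprn_gt0// mulr_gt0//.
  by rewrite rt_gt0 ?ltr0n.
by rewrite rtq_gt0 ?ltr0n.
Qed.

Lemma bin_gauge_le k w m N n : (0 < k)%N -> (0 < N)%N -> (N <= n)%N ->
  'C(N, m)%:R * rt k (w%:R / N%:R) ^+ m <= gauge k w m n.
Proof.
move=> k0 N0 Nn; have N0R : 0 < N%:R :> R by rewrite ltr0n.
rewrite rtM ?invr_ge0 ?ler0n// rtV// exprMn /gauge exprMn mulrCA -mulrA.
rewrite ler_wpM2l ?exprn_ge0 ?rt_ge0// ler_pdivlMr ?ltr0n ?fact_gt0//.
rewrite mulrAC -natrM bin_ffact.
apply: (@le_trans _ _ (rtq k N%:R ^+ m)).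
  rewrite /rtq exprMn ler_wpM2r ?exprn_ge0 ?invr_ge0 ?rt_ge0//.
  by rewrite -natrX ler_nat ffact_leX.
by rewrite lerXn2r ?nnegrE ?rtq_ge0 ?ler0n// ler_rtq ?ler0n ?ler_nat.
Qed.

(** The hypothesis on n + m says N - m >= n - 2k, so the falling factorial of N is at least (n -
    2k)^m. The root of N in the denominator is at most that of n. *)
Lemma bin_gauge_ge k w m N n : (0 < k)%N -> (0 < N)%N -> (N <= n)%N ->
  (n + m <= N + 2 * k)%N -> (2 * k <= n)%N ->
  gauge k w m n * (1 - (2 * k)%:R / n%:R) ^+ m
  <= 'C(N, m)%:R * rt k (w%:R / N%:R) ^+ m.
Proof.
move=> k0 N0 Nn nN kn; have N0R : 0 < N%:R :> R by rewrite ltr0n.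
have n0R : 0 < n%:R :> R by rewrite ltr0n; lia.
rewrite rtM ?invr_ge0 ?ler0n// rtV// exprMn /gauge exprMn.
rewrite [leRHS]mulrCA -!mulrA ler_wpM2l ?exprn_ge0 ?rt_ge0//.
rewrite mulrCA ler_pdivrMl ?ltr0n ?fact_gt0// mulrA -natrM [(m`! * _)%N]mulnC bin_ffact.
rewrite -exprMn.
have -> : rtq k n%:R * (1 - (2 * k)%:R / n%:R) = (n - 2 * k)%:R / rt k n%:R :> R.
  rewrite natrB// /rtq; field; rewrite !gt_eqF//; exact: rt_gt0.
rewrite exprMn ler_pM ?exprn_ge0 ?invr_ge0 ?rt_ge0 ?ler0n//.
  rewrite -natrX ler_nat (leq_trans _ (leX_ffact _ _))//.
  have [m0|m0] := posnP m; first by rewrite m0 !expn0.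
  by rewrite leq_exp2r//; lia.
by rewrite lerXn2r ?nnegrE ?invr_ge0 ?rt_ge0// lef_pV2 ?posrE ?rt_gt0// ler_rt ?ler_nat ?ler0n.
Qed.

End Gauge.

Section Extremal.
Context {R : realType} {n : nat}.
Implicit Types (k u w : nat) (C : {set 'I_n}) (BB : {set {set 'I_n}}).

Lemma core_family_le_gauge k u w C BB (a : 'I_n -> R) (alpha : R) (x : 'I_n -> R) :
  (0 < k)%N -> (u <= k)%N -> (#|C| < n)%N -> uniform_on u C BB ->
  (forall i, i \in C -> 0 < a i) ->
  (forall B, B \in BB -> \prod_(i in B) a i = alpha) ->
  (forall i, i \in C -> (degree BB i)%:R <= #|BB|%:R * a i ^+ k) ->
  (0 < w)%N -> (k - u <= w)%N -> (forall i, 0 <= x i) ->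
  k%:R * edge_poly (core_family k C BB) x
  <= #|BB|%:R * alpha * gauge k w (k - u) n * \sum_i x i ^+ k.
Proof.
move=> k0 uk Cn BBu a0 BBa adeg w0 kw x0.
have N0 : 0 < (n - #|C|)%:R :> R by rewrite ltr0n subn_gt0.
have [->|[B0 B0BB]] := finset.set_0Vmem BB.
  rewrite finset.cards0 !mul0r /edge_poly big1 ?mulr0// => e.
  by rewrite !finset.inE andbF.
have alpha0 : 0 <= alpha.
  rewrite -(BBa _ B0BB); apply: prodr_ge0 => i iB0; apply/ltW/a0.
  by have [/fintype.subsetP ->] := BBu _ B0BB.
pose z : R := rt k (w%:R / (n - #|C|)%:R).
have z0 : 0 < z by rewrite rt_gt0// divr_gt0// ltr0n.
have zw : (k - u)%:R <= (n - #|C|)%:R * z ^+ k.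
  by rewrite rtX ?divr_ge0 ?ler0n// mulrCA mulfV ?gt_eqF// mulr1 ler_nat.
apply: le_trans (core_family_upper k0 uk BBu a0 z0 BBa adeg zw x0) _.
apply: ler_wpM2r; first by apply: sumr_ge0 => i _; exact: exprn_ge0.
rewrite -mulrA ler_wpM2l ?mulr_ge0 ?ler0n//.
by rewrite bin_gauge_le ?leq_subr// subn_gt0.
Qed.

Lemma rho_core_family_ge k u C BB (a : 'I_n -> R) (alpha : R) :
  (0 < k)%N -> (u <= k)%N -> (n + (k - u) <= (n - #|C|) + 2 * k)%N ->
  (2 * k <= n)%N -> (#|C| < n)%N -> uniform_on u C BB ->
  (forall i, i \in C -> 0 <= a i) -> 0 <= alpha ->
  (forall B, B \in BB -> \prod_(i in B) a i = alpha) ->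
  \sum_(i in C) a i ^+ k = u%:R ->
  #|BB|%:R * alpha * gauge k (k - u) (k - u) n
    * (1 - (2 * k)%:R / n%:R) ^+ (k - u)
  <= rho R k (core_family k C BB).
Proof.
move=> k0 uk nk kn Cn BBu a0 alpha0 BBa aC.
have N0 : 0 < (n - #|C|)%:R :> R by rewrite ltr0n subn_gt0.
pose z : R := rt k ((k - u)%:R / (n - #|C|)%:R).
have zw : (n - #|C|)%:R * z ^+ k = (k - u)%:R.
  by rewrite rtX ?divr_ge0 ?ler0n// mulrCA mulfV ?gt_eqF// mulr1.
apply: le_trans (core_family_lower k0 uk BBu a0 (rt_ge0 _ _) BBa aC zw).
rewrite -[leLHS]mulrA -[leRHS]mulrA ler_wpM2l ?mulr_ge0 ?ler0n//.
by rewrite bin_gauge_ge ?leq_subr// subn_gt0.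
Qed.

End Extremal.

(** * Leading parts of the candidates and the lower order terms *)

Section StarNear.
Import mathcomp.boot.fintype mathcomp.boot.finset.
Context {n : nat}.
Implicit Types (k t : nat) (S V Y U : {set 'I_n}) (F G : {set {set 'I_n}}).

(** Exactly one petal of V is allowed, since edges with two petals contain a set of size |S| + 2 and
    are of lower order. In the same way [near_family] is the leading part of A, and [up_family]
    collects the edges that are charged to one larger set. *)
Definition star_family k S V := core_family k (S :|: V) [set v |: S | v in V].
Definition near_family k Y := core_family k Y [set Y :\ j | j in Y].
Definition up_family k U := core_family k U [set U].

Lemma star_uniform S V : [disjoint S & V] ->
  uniform_on #|S|.+1 (S :|: V) [set v |: S | v in V].
Proof.
move=> dSV _ /imsetP[v vV ->]; split.
  by rewrite subUset sub1set inE vV orbT subsetUl.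
by rewrite cardsU1 (disjointFl dSV vV).
Qed.

Lemma card_star S V : [disjoint S & V] -> #|[set v |: S | v in V]| = #|V|.
Proof.
move=> dSV; rewrite card_in_imset// => v w vV wV /setP/(_ v).
by rewrite !inE eqxx (disjointFl dSV vV) !orbF => /esym/eqP.
Qed.

Lemma near_uniform Y : uniform_on #|Y|.-1 Y [set Y :\ j | j in Y].
Proof.
move=> _ /imsetP[j jY ->]; rewrite subD1set; split => //.
by rewrite [in RHS](cardsD1 j) jY.
Qed.

Lemma card_near Y : #|[set Y :\ j | j in Y]| = #|Y|.
Proof.
rewrite card_in_imset// => i j iY jY /setP/(_ i).
by rewrite !inE eqxx iY andbT/=; case: eqP.
Qed.

Lemma up_familyE k U (e : {set 'I_n}) :
  (e \in up_family k U) = (#|e| == k) && (U \subset e).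
Proof. by rewrite !inE; congr (_ && _); apply/eqP/setIidPr. Qed.

End StarNear.

Section StarNearRho.
Context {R : realType} {n : nat}.
Implicit Types (k t : nat) (S V Y U : {set 'I_n}) (F G : {set {set 'I_n}}).

(** A vertex of S lies in all |V| traces and a vertex of V in one only, which dictates the weights 1
    on S and |V|^(-1/k) on V. Each trace then has product |V|^(-1/k), and the |V| traces together
    give |V|^(1-1/k). The set V may be empty; both sides then vanish. *)
Lemma star_family_le k t S V (x : 'I_n -> R) :
  [disjoint S & V] -> #|S| = t -> (t.+1 < k)%N -> (t + #|V| < n)%N ->
  (forall i, 0 <= x i) ->
  k%:R * edge_poly (star_family k S V) x
  <= rtq k #|V|%:R * gauge k (k - t.+1) (k - t.+1) n * \sum_i x i ^+ k.
Proof.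
move=> dSV St tk tVn x0.
have Cn : (#|S :|: V| < n)%N.
  by apply: leq_trans tVn; rewrite ltnS -St leq_card_setU.
pose a i : R := if i \in S then 1 else (rt k #|V|%:R)^-1.
have V0 i : i \in V -> 0 < #|V|%:R :> R.
  by move=> iV; rewrite ltr0n finset.card_gt0; apply/finset.set0Pn; exists i.
have iC i : i \in S :|: V -> i \notin S -> i \in V.
  by rewrite finset.inE => /orP[->|].
have BBu := star_uniform dSV.
rewrite St in BBu.
have /= := @core_family_le_gauge R n k t.+1 (k - t.+1) _ _ a (rt k #|V|%:R)^-1
  x _ _ Cn BBu.
rewrite card_star//; apply => //.
- lia.
- lia.
- move=> i iSV; rewrite /a; case: ifPn => // /(iC _ iSV) iV.
  by rewrite invr_gt0 rt_gt0// (V0 i).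
- move=> _ /imsetP[v vV ->].
  have vS : v \notin S by rewrite (disjointFl dSV vV).
  rewrite big_setU1//= {1}/a (negbTE vS) big1 ?mulr1// => i iS.
  by rewrite /a iS.
- move=> i iSV; rewrite /a; case: ifPn => [iS|/(iC _ iSV) iV].
    rewrite expr1n mulr1 ler_nat -[leqRHS](card_star dSV) subset_leq_card//.
    by apply/fintype.subsetP => B; rewrite finset.inE => /andP[].
  rewrite exprVn rtX ?ler0n ?mulfV ?gt_eqF ?(V0 i)//; last lia.
  rewrite lern1 -(finset.cards1 (i |: S)%SET) subset_leq_card//.
  apply/fintype.subsetP => B; rewrite !finset.inE => /andP[/imsetP[v vV ->]].
  by rewrite !finset.inE (disjointFl dSV iV) orbF => /eqP ->.
- lia.
Qed.

Lemma rho_star_family_ge k t S V :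
  [disjoint S & V] -> #|S| = t -> (t.+1 < k)%N -> (0 < #|V|)%N ->
  (t + #|V| <= k.+1)%N -> (2 * k <= n)%N ->
  rtq k #|V|%:R * gauge k (k - t.+1) (k - t.+1) n
    * (1 - (2 * k)%:R / n%:R) ^+ (k - t.+1)
  <= rho R k (star_family k S V).
Proof.
move=> dSV St tk V0 tVk kn.
have V0R : 0 < #|V|%:R :> R by rewrite ltr0n.
have CE : #|S :|: V|%SET = (t + #|V|)%N.
  by rewrite -St finset.cardsU disjoint_setI0// finset.cards0 subn0.
pose a i : R := if i \in S then 1 else (rt k #|V|%:R)^-1.
have BBu := star_uniform dSV.
rewrite St in BBu.
have /= := @rho_core_family_ge R n k t.+1 _ _ a (rt k #|V|%:R)^-1 _ _ _ kn _ BBu.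
rewrite card_star// CE; apply => //; [lia|lia|lia|lia| | | |].
- by move=> i _; rewrite /a; case: ifP => // _; rewrite invr_ge0 rt_ge0.
- by rewrite invr_ge0 rt_ge0.
- move=> _ /imsetP[v vV ->].
  have vS : v \notin S by rewrite (disjointFl dSV vV).
  rewrite big_setU1//= {1}/a (negbTE vS) big1 ?mulr1// => i iS.
  by rewrite /a iS.
- rewrite -natr1 (eq_bigl [predU S & V]) => [|i]; last by rewrite !finset.inE.
  rewrite bigU//=; congr (_ + _).
    rewrite (eq_bigr (fun=> 1)) => [|i iS]; last by rewrite /a iS expr1n.
    by rewrite sumr_const St.
  rewrite (eq_bigr (fun=> #|V|%:R^-1)) => [|i iV]; last first.
    by rewrite /a (disjointFl dSV iV) exprVn rtX ?ler0n//; lia.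
  by rewrite sumr_const -[LHS]mulr_natl mulfV ?gt_eqF.
Qed.

(** The counterpart for A of |V|^(1-1/k). Each vertex of Y lies in t + 1 of the t + 2 traces, so its
    weight a satisfies a^k = (t + 1) / (t + 2), and the traces together give (t + 2) a^(t + 1). *)
Definition near_weight k t : R :=
  t.+2%:R * rt k (t.+1%:R / t.+2%:R) ^+ t.+1.

Lemma near_family_le k t Y (x : 'I_n -> R) :
  #|Y| = t.+2 -> (t.+1 < k)%N -> (k < n)%N -> (forall i, 0 <= x i) ->
  k%:R * edge_poly (near_family k Y) x
  <= near_weight k t * gauge k (k - t.+1) (k - t.+1) n * \sum_i x i ^+ k.
Proof.
move=> Yt tk kn x0; have k0 : (0 < k)%N by lia.
have BBu := near_uniform (Y := Y).
rewrite Yt/= in BBu.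
have r0 : 0 < t.+1%:R / t.+2%:R :> R by rewrite divr_gt0 ?ltr0n.
have /= := @core_family_le_gauge R n k t.+1 (k - t.+1) _ _
  (fun=> rt k (t.+1%:R / t.+2%:R)) (rt k (t.+1%:R / t.+2%:R) ^+ t.+1)
  x _ _ _ BBu.
rewrite card_near Yt; apply => //; [lia|lia| | | |lia].
- by move=> i _; exact: rt_gt0.
- by move=> B /BBu[_ Bt]; rewrite prodr_const Bt.
- move=> i iY; rewrite rtX ?(ltW r0)// mulrCA mulfV ?mulr1 ?pnatr_eq0//.
  have -> : t.+1 = #|Y :\ i|%SET by have := finset.cardsD1 i Y; rewrite iY Yt add1n => -[].
  rewrite ler_nat (leq_trans _ (leq_imset_card (fun j => Y :\ j)%SET _))//.
  apply/subset_leq_card/fintype.subsetP => B; rewrite finset.inE.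
  move=> /andP[/imsetP[j jY ->]]; rewrite finset.in_setD1 => /andP[ij _].
  by apply: imset_f; rewrite finset.in_setD1 eq_sym ij.
Qed.

Lemma rho_near_family_ge k t Y :
  #|Y| = t.+2 -> (t.+1 < k)%N -> (2 * k <= n)%N ->
  near_weight k t * gauge k (k - t.+1) (k - t.+1) n
    * (1 - (2 * k)%:R / n%:R) ^+ (k - t.+1)
  <= rho R k (near_family k Y).
Proof.
move=> Yt tk kn; have k0 : (0 < k)%N by lia.
have BBu := near_uniform (Y := Y).
rewrite Yt/= in BBu.
have r0 : 0 < t.+1%:R / t.+2%:R :> R by rewrite divr_gt0 ?ltr0n.
have /= := @rho_core_family_ge R n k t.+1 _ _
  (fun=> rt k (t.+1%:R / t.+2%:R)) (rt k (t.+1%:R / t.+2%:R) ^+ t.+1)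
  _ _ _ kn _ BBu.
rewrite card_near Yt; apply => //; [lia|lia|lia| | | |].
- by move=> i _; exact: rt_ge0.
- by rewrite exprn_ge0 ?rt_ge0.
- by move=> B /BBu[_ Bt]; rewrite prodr_const Bt.
- rewrite sumr_const Yt rtX ?(ltW r0)// -[LHS]mulr_natl mulrCA mulfV ?mulr1//.
Qed.

(** The parameter w of the gauge is k - t - 1 although only k - t - 2 vertices are free. This keeps
    w positive when k = t + 2 and matches the gauge of the leading terms. *)
Lemma up_family_le k t U (x : 'I_n -> R) :
  #|U| = t.+2 -> (t.+1 < k)%N -> (k < n)%N -> (forall i, 0 <= x i) ->
  k%:R * edge_poly (up_family k U) x
  <= gauge k (k - t.+1) (k - t.+2) n * \sum_i x i ^+ k.
Proof.
move=> Ut tk kn x0.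
have /= := @core_family_le_gauge R n k t.+2 (k - t.+1) U [set U]%SET
  (fun=> 1) 1 x.
rewrite finset.cards1 !mul1r; apply => //; [lia|rewrite Ut; lia| | | |lia|lia].
- by move=> B; rewrite finset.inE => /eqP ->.
- by move=> B _; rewrite big1.
- move=> i _; rewrite expr1n lern1 -(finset.cards1 U).
  by apply/subset_leq_card/fintype.subsetP => B; rewrite finset.inE => /andP[].
Qed.

(** The quotient of the two gauges is m / (rt k m * rtq k n), and rt k m >= 1. So fixing one more
    vertex costs a factor of order n^(1-1/k). *)
Lemma gauge_pred k m : (0 < n)%N -> (0 < m)%N ->
  gauge k m m.-1 n <= gauge k m m n * (m%:R / rtq k n%:R) :> R.
Proof.
move=> n0; case: m => // m _ /=.
have q0 : 0 < rtq k n%:R :> R by rewrite rtq_gt0 ?ltr0n.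
have r1 : 1 <= rt k m.+1%:R :> R by rewrite rt_ge1// ler1n.
have g0 : 0 < gauge k m.+1 m n :> R by exact: gauge_gt0.
suff -> : gauge k m.+1 m.+1 n * (m.+1%:R / rtq k n%:R)
    = gauge k m.+1 m n * rt k m.+1%:R :> R by rewrite ler_pMr.
rewrite /gauge factS natrM exprSr; field.
by rewrite pnatr_eq0 -lt0n fact_gt0 gt_eqF//= -natr1 natr1 pnatr_eq0.
Qed.

Lemma edge_poly_cover k F G (s : seq {set 'I_n}) (x : 'I_n -> R) :
  kgraph k F -> (forall i, 0 <= x i) ->
  (forall e, e \in F -> e \in G \/ exists2 U, U \in s & U \subset e) ->
  edge_poly F x <= edge_poly G x + \sum_(U <- s) edge_poly (up_family k U) x.
Proof.
move=> Fk x0; elim: s F Fk => [|U s IH] F Fk FGs.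
  rewrite big_nil addr0 edge_polyS//; apply/fintype.subsetP => e /FGs.
  by case=> // -[].
pose F' := [set e in F | ~~ (U \subset e)]%SET.
have FF' : F \subset F' :|: up_family k U.
  apply/fintype.subsetP => e eF.
  by rewrite finset.in_setU up_familyE finset.inE eF Fk// eqxx orNb.
apply: le_trans (edge_polyS x0 FF') _; apply: le_trans (edge_poly_setU _ _ x0) _.
rewrite big_cons addrCA [leLHS]addrC lerD2l; apply: IH => e.
  by rewrite finset.inE => /andP[/Fk].
rewrite finset.inE => /andP[/FGs[|[W]]]; first by left.
rewrite inE => /predU1P[->->//|Ws We _].
by right; exists W.
Qed.

Lemma cover_le k t S V F (s : seq {set 'I_n}) (x : 'I_n -> R) :
  kgraph k F -> [disjoint S & V] -> #|S| = t -> (t.+1 < k)%N -> (k < n)%N ->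
  (t + #|V| < n)%N -> (forall i, 0 <= x i) ->
  (forall U, U \in s -> #|U| = t.+2) ->
  (forall e, e \in F ->
     e \in star_family k S V \/ exists2 U, U \in s & U \subset e) ->
  k%:R * edge_poly F x
  <= (rtq k #|V|%:R + (size s * (k - t.+1))%:R / rtq k n%:R)
     * gauge k (k - t.+1) (k - t.+1) n * \sum_i x i ^+ k.
Proof.
move=> Fk dSV St tk kn tVn x0 st Fs.
have X0 : 0 <= \sum_i x i ^+ k.
  by apply: sumr_ge0 => i _; exact: exprn_ge0.
apply: (@le_trans _ _ (k%:R * (edge_poly (star_family k S V) x
  + \sum_(U <- s) edge_poly (up_family k U) x))).
  by rewrite ler_wpM2l ?ler0n//; exact: edge_poly_cover.
rewrite mulrDr !mulrDl; apply: lerD; first exact: star_family_le.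
rewrite big_distrr/= -mulrA mulrAC natrM -mulrA.
apply: (@le_trans _ _ (\sum_(U <- s) gauge k (k - t.+1) (k - t.+2) n *
  \sum_i x i ^+ k)).
  rewrite big_seq [leRHS]big_seq; apply: ler_sum => U /st Ut; exact: up_family_le.
rewrite big_const_seq count_predT iter_addr_0 -[leLHS]mulr_natl.
rewrite -[leRHS]mulrA ler_wpM2l ?ler0n//.
have := @gauge_pred k (k - t.+1); rewrite -subnS; move=> /(_ _ _).
move=> g; apply: le_trans (ler_wpM2r X0 (g _ _)) _; [lia|lia|].
by rewrite le_eqVlt; apply/orP; left; apply/eqP; ring.
Qed.

End StarNearRho.

(** * Families beaten by H *)

Lemma expn16_le k : (3 <= k)%N -> (16 ^ k <= 100 ^ k.-1)%N.
Proof.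
case: k => // -[//|[//|k]] _; rewrite [k.+3.-1]/=.
elim: k => [//|k IH]; rewrite expnS [leqRHS]expnS; exact: leq_mul.
Qed.

(** Compare the factors separately: 8^k and the surplus 2^k of 2^(k k) over 2^(k (k - 1)) combine to
    16^k <= 100^(k-1), and 4 k <= 7 (k - 1) handles the powers of k. Both hold from k = 3 on. *)
Lemma large_n_expn k : (3 <= k)%N ->
  ((8 * 2 ^ k * k ^ 4) ^ k <= (100 * 2 ^ k * k ^ 7) ^ k.-1)%N.
Proof.
move=> k3; rewrite (expnMn _ (k ^ 4)) (expnMn _ (k ^ 7)) (expnMn 8) (expnMn 100) -!expnM.
have -> : (k * k = k * k.-1 + k)%N by rewrite -mulnSr prednK//; lia.
rewrite expnD [leqLHS](_ : _ = 16 ^ k * 2 ^ (k * k.-1) * k ^ (4 * k))%N; last first.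
  by rewrite (_ : 16 = 8 * 2)%N// (expnMn 8 2); congr (_ * _)%N; rewrite mulnA mulnAC.
by rewrite !leq_mul ?expn16_le// leq_pexp2l//; lia.
Qed.

Section Comparison.
Context {R : realType}.

Lemma bernoulliB (m : nat) (d : R) : 0 <= d <= 1 -> 1 - m%:R * d <= (1 - d) ^+ m.
Proof.
move=> /andP[d0 d1]; elim: m => [|m IH]; first by rewrite mul0r subr0 expr0.
rewrite exprS (le_trans _ (ler_wpM2l _ IH)) ?subr_ge0//.
have : 0 <= m%:R * d * d by rewrite !mulr_ge0.
rewrite -natr1; lra.
Qed.

Lemma rtq_large k n : (3 <= k)%N -> (100 * 2 ^ k * k ^ 7 <= n)%N ->
  (8 * 2 ^ k * k ^ 4)%:R <= rtq k n%:R :> R.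
Proof.
move=> k3 kn; have n0 : (0 < n)%N.
  by apply: leq_trans kn; rewrite !muln_gt0 !expn_gt0; lia.
rewrite -(@ler_pXn2r _ k) ?nnegrE ?rtq_ge0 ?ler0n//; last lia.
rewrite rtqX ?ltr0n//; last lia.
rewrite -!natrX ler_nat (leq_trans (large_n_expn k3))// leq_exp2r//; lia.
Qed.

(** By [rtq_gap] one more petal gains at least 1 / (2 r), where r is the k-th root of k - t + 1.
    Since k - t + 1 <= 2^k, r <= 2 and the gain is at least 1/4. The two losses are at most 1/24 for
    the L sets and 1/50 for the lower bound on the star. *)
Lemma star_gap k t n L : (t.+1 < k)%N -> (0 < t)%N ->
  (100 * 2 ^ k * k ^ 7 <= n)%N -> (L <= 2 ^ k * k ^ 2)%N ->
  rtq k (k - t)%:R + (L * (k - t.+1))%:R / rtq k n%:R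
  < rtq k (k - t).+1%:R * (1 - (2 * k)%:R / n%:R) ^+ (k - t.+1) :> R.
Proof.
move=> tk t0 kn Lk; have k3 : (3 <= k)%N by lia.
have Q8 := rtq_large k3 kn.
have k0R : 3 <= k%:R :> R by rewrite ler_nat.
have K1 : (1 <= 2 ^ k * k ^ 2)%N by rewrite muln_gt0 !expn_gt0; lia.
(* This makes the Bernoulli error k * k * (2 k / n) at most 1/50. *)
have n2 : (2 * k ^ 2 * k * 50 <= n)%N.
  apply: leq_trans kn; have := leq_pmull (k ^ 3) (_ : 0 < 2 ^ k * k ^ 4)%N.
  rewrite !muln_gt0 !expn_gt0 => /(_ _); nia.
have kn2 : (2 * k <= n)%N by nia.
have n0 : 0 < n%:R :> R by rewrite ltr0n; nia.
have Q0 : 0 < rtq k n%:R :> R by rewrite rtq_gt0.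
have r0 : 0 < rt k (k - t).+1%:R :> R by rewrite rt_gt0.
have r1 : 1 <= rt k (k - t).+1%:R :> R by rewrite rt_ge1// ler1n.
have r2 : rt k (k - t).+1%:R <= 2 :> R.
  rewrite -(@ler_pXn2r _ k) ?nnegrE ?rt_ge0//; last lia.
  rewrite rtX//; last lia.
  by rewrite -natrX ler_nat (leq_trans _ (ltnW (ltn_expl k _)))//; lia.
have A1 : (L * (k - t.+1))%:R / rtq k n%:R <= 24^-1 :> R.
  rewrite ler_pdivrMr// ler_pdivlMl// (le_trans _ Q8)// -natrM ler_nat.
  have : (L * (k - t.+1) <= 2 ^ k * k ^ 2 * k)%N by rewrite leq_mul//; lia.
  have := leq_mul (leqnn (8 * (2 ^ k * k ^ 2 * k))%N) k3.
  rewrite (_ : (8 * 2 ^ k * k ^ 4)%N = (8 * (2 ^ k * k ^ 2 * k) * k)%N); lia.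
have A2 : 4^-1 <= (2 * rt k (k - t).+1%:R)^-1 :> R.
  by rewrite lef_pV2 ?posrE ?mulr_gt0//; lra.
have G := @rtq_gap R k (k - t) (ltac:(lia)) (ltac:(lia)).
have B : 1 - (k - t.+1)%:R * ((2 * k)%:R / n%:R)
    <= (1 - (2 * k)%:R / n%:R) ^+ (k - t.+1) :> R.
  apply: bernoulliB; rewrite divr_ge0 ?ler0n//= ler_pdivrMr// mul1r ler_nat//.
have P0 : 0 <= rtq k (k - t).+1%:R :> R by rewrite rtq_ge0.
have A3 : rtq k (k - t).+1%:R * ((k - t.+1)%:R * ((2 * k)%:R / n%:R)) <= 50^-1 :> R.
  apply: (@le_trans _ _ (k%:R * (k%:R * ((2 * k)%:R / n%:R)))).
    apply: ler_pM => //.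
      rewrite /rtq ler_pdivrMr// (@le_trans _ _ k%:R) ?ler_nat//; first lia.
      by rewrite ler_peMr ?ler0n.
    by rewrite ler_wpM2r ?divr_ge0 ?ler0n// ler_nat leq_subr.
  rewrite !mulrA ler_pdivrMr// ler_pdivlMl// -!natrM ler_nat.
  by apply: leq_trans n2; lia.
have := ler_wpM2l P0 B; rewrite mulrBr mulr1; lra.
Qed.

Lemma rho_cover_lt k t n (S V S0 V0 : {set 'I_n}) (F : {set {set 'I_n}})
    (s : seq {set 'I_n}) :
  (0 < t)%N -> (t.+1 < k)%N -> (100 * 2 ^ k * k ^ 7 <= n)%N ->
  kgraph k F -> [disjoint S & V] -> #|S| = t -> (#|V| <= k - t)%N ->
  (forall U, U \in s -> #|U| = t.+2) -> (size s <= 2 ^ k * k ^ 2)%N ->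
  (forall e, e \in F ->
     e \in star_family k S V \/ exists2 U, U \in s & U \subset e) ->
  [disjoint S0 & V0] -> #|S0| = t -> #|V0| = (k - t).+1 ->
  rho R k F < rho R k (star_family k S0 V0).
Proof.
move=> t0 tk kn Fk dSV St Vk st ss Fs dSV0 St0 Vt0.
have k2n : (2 * k < n)%N.
  apply: leq_trans kn; have := leq_pmull (k ^ 7) (_ : 0 < 2 ^ k)%N.
  rewrite !expn_gt0 => /(_ erefl).
  have : (k ^ 1 <= k ^ 7)%N by rewrite leq_pexp2l//; lia.
  nia.
apply: rho_lt => [||x x0 xk]; [lia|lia|].
apply: le_lt_trans (cover_le Fk dSV St tk _ _ x0 st Fs) _; [lia|lia|].
rewrite xk mulr1; apply: lt_le_trans (rho_star_family_ge dSV0 St0 tk _ _ _).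
- rewrite Vt0 mulrAC ltr_pM2r ?gauge_gt0//; [|lia|lia].
  apply: le_lt_trans (star_gap tk t0 kn ss); rewrite lerD2r.
  by apply: ler_rtq; rewrite ?ler_nat//; lia.
- by rewrite Vt0.
- rewrite Vt0; lia.
- exact: ltnW.
Qed.

End Comparison.

(** * Maximal nontrivial intersecting families *)

Section Structure.
Import mathcomp.boot.fintype mathcomp.boot.finset.
Local Open Scope nat_scope.
Context {n : nat}.
Implicit Types (k t m c : nat) (S T U V Y e : {set 'I_n}) (F G : {set {set 'I_n}}).
Implicit Types (P Q : {set 'I_n} -> Prop).

Lemma exists_subset_card U m : m <= #|U| ->
  exists2 A : {set 'I_n}, A \subset U & #|A| = m.
Proof.
rewrite -bin_gt0 -cards_draws card_gt0 => /set0Pn[A].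
by rewrite inE => /andP[AU /eqP Am]; exists A.
Qed.

(** Versions of the candidates on an arbitrary core, since the structural argument finds the core
    inside F; [exists_perm_seg] moves it to an initial segment later. *)
Definition Aset k t Y : {set {set 'I_n}} :=
  [set e : {set 'I_n} | (#|e| == k) && (t.+1 <= #|e :&: Y|)].

Definition Hset k S V : {set {set 'I_n}} :=
  [set e : {set 'I_n} | [&& #|e| == k, S \subset e & e :&: V != set0]]
  :|: [set (S :|: V) :\ j | j in S].

Definition is_cover t F T : Prop := forall e, e \in F -> t <= #|e :&: T|.

Lemma is_coverPn t F T : ~ is_cover t F T -> exists2 e, e \in F & #|e :&: T| < t.
Proof.
move=> nT; have /exists_inP[e eF] : [exists e in F, #|e :&: T| < t].
  apply: contra_notT nT => /exists_inPn h e /h; by rewrite -leqNgt.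
by exists e.
Qed.

(** The predicate P carries side conditions on edges through the branching, such as avoiding a given
    vertex, while the bound c depends on k and t but not on n. *)
Definition covered F m c P : Prop :=
  exists s : seq {set 'I_n}, [/\ size s <= c, forall U, U \in s -> #|U| = m
    & forall e, e \in F -> P e -> exists2 U, U \in s & U \subset e].

Lemma coveredW F m c c' P P' : c <= c' ->
  (forall e, e \in F -> P' e -> P e) -> covered F m c P -> covered F m c' P'.
Proof.
move=> cc PP [s [sc sm sP]]; exists s; split => // [|e eF /(PP _ eF)].
  exact: leq_trans cc.
exact: sP.
Qed.

Lemma covered0 F m c P : (forall e, e \in F -> ~ P e) -> covered F m c P.
Proof. by move=> nP; exists [::]; split => // e /nP. Qed.

Lemma covered_superset F m U P : m <= #|U| ->
  (forall e, e \in F -> P e -> U \subset e) -> covered F m 1 P.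
Proof.
move=> /exists_subset_card[A AU Am] PU; exists [:: A]; split => //.
  by move=> B; rewrite inE => /eqP ->.
by move=> e eF /(PU _ eF) Ue; exists A; rewrite ?inE//; exact: subset_trans Ue.
Qed.

Lemma coveredU F m c c' P P' : covered F m c P -> covered F m c' P' ->
  covered F m (c + c') (fun e => P e \/ P' e).
Proof.
move=> [s [sc sm sP]] [s' [sc' sm' sP']]; exists (s ++ s'); split.
- by rewrite size_cat leq_add.
- by move=> U; rewrite mem_cat => /orP[/sm|/sm'].
- by move=> e eF [/(sP _ eF)|/(sP' _ eF)] [U Us Ue];
    exists U; rewrite // mem_cat Us ?orbT.
Qed.

Lemma covered_bigU (I : eqType) (r : seq I) F m c d P (Pi : I -> {set 'I_n} -> Prop) :
  size r <= d -> (forall i, i \in r -> covered F m c (Pi i)) ->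
  (forall e, e \in F -> P e -> exists2 i, i \in r & Pi i e) ->
  covered F m (d * c) P.
Proof.
move=> rd rc rP; apply: (@coveredW _ _ (size r * c) _
  (fun e => exists2 i, i \in r & Pi i e)) => //.
  by rewrite leq_mul2r rd orbT.
elim: r {rd rP} rc => [|i r IH] rc.
  by apply: covered0 => e _ [].
rewrite mulSn; apply: (coveredW (leqnn _) _ (coveredU (rc i _) (IH _))).
- by move=> e eF [j]; rewrite inE => /predU1P[->|]; [left|right; exists j].
- by rewrite inE eqxx.
- by move=> j jr; apply: rc; rewrite inE jr orbT.
Qed.

Section Family.
Variables (k t : nat) (F : {set {set 'I_n}}).
Hypotheses (Fk : kgraph k F) (Ft : tintersecting t F) (Fnt : ~ trivial_family k t F).
Hypothesis tk : t.+1 < k.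

(** Such a T would be contained in every edge and be the center of a star. *)
Lemma tset_noncover T : #|T| = t -> ~ is_cover t F T.
Proof.
move=> Tt Tc; apply: Fnt; exists T => //; apply/subsetP => e eF.
rewrite inE Fk// eqxx/=; apply/setIidPr/eqP.
by rewrite eqEcard subsetIr Tt Tc.
Qed.

(* Every edge containing U meets an edge f with #|f :&: U| < t outside U. *)
Lemma covered_branch U m c P : ~ is_cover t F U ->
  (forall u, u \notin U -> covered F m c (fun e => u |: U \subset e /\ P e)) ->
  covered F m (k * c) (fun e => U \subset e /\ P e).
Proof.
move=> /is_coverPn[f fF fU] cu.
apply: (@covered_bigU _ (enum (f :\: U)) _ _ _ _ _
  (fun u e => u |: U \subset e /\ P e)).
- by rewrite -cardE -(Fk fF) subset_leq_card// subsetDl.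
- by move=> u; rewrite mem_enum inE => /andP[/cu].
move=> e eF [Ue Pe].
have [u ue uU] : exists2 u, u \in e :&: f & u \notin U.
  apply/subsetPn; apply: contraL fU => efU; rewrite -leqNgt.
  apply: leq_trans (Ft eF fF) _; apply: subset_leq_card.
  by rewrite subsetI subsetIr.
move: ue; rewrite inE => /andP[ue uf]; exists u.
  by rewrite mem_enum inE uU.
by rewrite subUset sub1set ue Ue.
Qed.

(** Two branchings lead from size t to size t + 2, with k choices each. A t-set can always branch
    because F is nontrivial. A (t+1)-set can branch unless it is a cover, and then no edge
    satisfying P contains it. *)
Lemma covered_avoiding P U :
  (forall T e, #|T| = t.+1 -> is_cover t F T -> e \in F -> P e -> ~ T \subset e) ->
  t <= #|U| -> covered F t.+2 (k ^ 2) (fun e => U \subset e /\ P e).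
Proof.
move=> PT tU; have k0 : 0 < k by lia.
have H (W : {set 'I_n}) : t < #|W| -> covered F t.+2 k (fun e => W \subset e /\ P e).
  rewrite leq_eqVlt => /orP[/eqP Wt|Wt].
    have [Wc|Wn] := pselect (is_cover t F W).
      by apply: covered0 => e eF [We Pe]; exact: (PT W e).
    rewrite -[k]muln1; apply: covered_branch => // u uW.
    apply: (covered_superset (U := u |: W)); first by rewrite cardsU1 uW -Wt.
    by move=> e _ [].
  apply: (coveredW k0 _ (covered_superset Wt (P := fun e => W \subset e) _)) => //.
  by move=> e _ [].
move: tU; rewrite leq_eqVlt => /orP[/eqP Ut|/H]; last first.
  by apply: coveredW => //; rewrite -{1}(expn1 k) leq_pexp2l.
apply: covered_branch => [|u uU]; first exact: tset_noncover.
by apply: H; rewrite cardsU1 uU Ut.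
Qed.

(** Every edge contains t elements of e0, so the branching starts from at most 2^k sets. *)
Lemma covered_no_cover e0 : e0 \in F ->
  (forall T, #|T| = t.+1 -> ~ is_cover t F T) ->
  covered F t.+2 (2 ^ k * k ^ 2) (fun=> True).
Proof.
move=> e0F nT.
apply: (@covered_bigU _ (enum [set A : {set 'I_n} | A \subset e0 & #|A| == t])
  _ _ _ _ _ (fun A e => A \subset e /\ True)).
- rewrite -cardE -(Fk e0F) -card_powerset subset_leq_card//.
  by apply/subsetP => A; rewrite !inE => /andP[].
- move=> A; rewrite mem_enum inE => /andP[_ /eqP At].
  by apply: covered_avoiding; rewrite ?At// => T e /nT.
move=> e eF _; have [A Ae At] := exists_subset_card (Ft eF e0F).
move: Ae; rewrite subsetI => /andP[Ae Ae0].
by exists A; rewrite ?mem_enum ?inE ?Ae0 ?At ?eqxx.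
Qed.

(** * All covers of size t + 1 share a common t-set *)

Section Sunflower.
Variables (S : {set 'I_n}).
Hypotheses (St : #|S| = t) (t0 : 0 < t).
Hypothesis SC : forall T, #|T| = t.+1 -> is_cover t F T -> S \subset T.
Hypothesis exC : exists2 T : {set 'I_n}, #|T| = t.+1 & is_cover t F T.

Definition petals : {set 'I_n} :=
  [set v | (v \notin S) && [forall e in F, t <= #|e :&: (v |: S)|]].
Local Notation V := petals.

Lemma disjoint_petals : [disjoint S & V].
Proof.
by rewrite disjoint_sym disjoints_subset; apply/subsetP => v; rewrite !inE => /andP[].
Qed.

Lemma petalsP v : reflect (v \notin S /\ is_cover t F (v |: S)) (v \in V).
Proof.
rewrite inE; apply: (iffP andP) => -[vS /forall_inP vc]; split=> //.
Qed.

Lemma cover_petals T : #|T| = t.+1 -> is_cover t F T ->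
  exists2 v, v \in V & T = v |: S.
Proof.
move=> Tt Tc; have ST := SC Tt Tc.
have /cards1P[v vE] : #|T :\: S| == 1 by rewrite cardsDS// Tt St subSnn.
have TE : T = v |: S by rewrite -vE setUC -{1}(setID T S) (setIidPr ST).
have vS : v \notin S by have := set11 v; rewrite -vE inE => /andP[].
by exists v => //; apply/petalsP; rewrite -TE.
Qed.

Lemma petals_gt0 : 0 < #|V|.
Proof.
have [T Tt /(cover_petals Tt)[v vV _]] := exC.
by rewrite card_gt0; apply/set0Pn; exists v.
Qed.

(** An edge e that misses part of S still meets v + S in t elements for every petal v. Hence it
    contains v and misses only one element of S. *)
Lemma not_center e : e \in F -> ~~ (S \subset e) ->
  exists j, [/\ j \in S, j \notin e & S :\ j :|: V \subset e].
Proof.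
move=> eF Se.
have eS : #|e :&: S| < t.
  rewrite -St ltn_neqAle subset_leq_card ?subsetIr// andbT.
  apply: contra Se => /eqP eSE; apply/setIidPr/eqP.
  by rewrite eqEcard subsetIr eSE leqnn.
have ev v : v \in V -> v \in e /\ #|e :&: S| = t.-1.
  move=> /petalsP[vS /(_ e eF)]; case: (boolP (v \in e)) => ve.
    have -> : e :&: (v |: S) = v |: (e :&: S).
      by apply/setP => i; rewrite !inE; case: eqP => [->|]; rewrite ?ve.
    by rewrite cardsU1 inE (negbTE vS) andbF => h; split=> //; lia.
  have -> : e :&: (v |: S) = e :&: S.
    by apply/setP => i; rewrite !inE; case: eqP => [->|]; rewrite ?(negbTE ve).
  by rewrite leqNgt eS.
have Ve : V \subset e by apply/subsetP => v /ev[].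
have [v vV] : exists v, v \in V by apply/set0Pn; rewrite -card_gt0 petals_gt0.
have [_ eS1] := ev _ vV.
have /cards1P[j jE] : #|S :\: e| == 1 by rewrite cardsD setIC eS1 St; lia.
have : j \in S :\: e by rewrite jE set11.
rewrite inE => /andP[je jS]; exists j; split => //.
rewrite subUset Ve andbT; apply/subsetP => i; rewrite !inE => /andP[ij iS].
apply: contraR ij => ie; have : i \in S :\: e by rewrite inE ie.
by rewrite jE inE.
Qed.

Lemma card_petals_union j : j \in S -> #|S :\ j :|: V| = t.-1 + #|V|.
Proof.
move=> jS; rewrite cardsU disjoint_setI0 ?cards0 ?subn0; last first.
  exact: disjointWl (subD1set _ _) disjoint_petals.
by congr (_ + _); rewrite -St (cardsD1 j S) jS.
Qed.

(** By nontriviality some edge does not contain S; it contains all petals and t - 1 elements of S,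
    which fit into k. *)
Lemma card_petals : #|V| <= (k - t).+1.
Proof.
have [f fF fS] := is_coverPn (tset_noncover St).
have [|j [jS _ /subset_leq_card]] := @not_center f fF.
  by apply: contraTN fS => /setIidPr ->; rewrite St ltnn.
by rewrite card_petals_union// (Fk fF); lia.
Qed.

(** In the extreme case an edge not containing S is filled up by its t - 1 elements of S and the
    petals, so it equals S + V minus one element of S. An edge containing S must meet V, as
    otherwise it would meet such an edge in t - 1 elements only. *)
Lemma sub_Hset : #|V| = (k - t).+1 -> F \subset Hset k S V.
Proof.
move=> Vk.
have HE e j : e \in F -> j \in S -> j \notin e -> S :\ j :|: V \subset e ->
    e = (S :|: V) :\ j.
  move=> eF jS je jVe; have -> : (S :|: V) :\ j = S :\ j :|: V.
    apply/setP => i; rewrite !(in_setD1, in_setU); case: eqP => [->|//].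
    by rewrite (disjointFr disjoint_petals jS).
  by apply/esym/eqP; rewrite eqEcard jVe card_petals_union// (Fk eF); lia.
have [f fF fS] := is_coverPn (tset_noncover St).
have Sf : ~~ (S \subset f).
  by apply: contraTN fS => /setIidPr ->; rewrite St ltnn.
have [j [jS jf jVf]] := not_center fF Sf.
have fE := HE _ _ fF jS jf jVf.
apply/subsetP => e eF; rewrite in_setU.
have [Se|Se] := boolP (S \subset e); last first.
  have [i [iS ie iVe]] := not_center eF Se.
  by apply/orP; right; apply/imsetP; exists i => //; exact: HE.
rewrite inE Fk// eqxx Se/=; apply/orP; left; apply/negP => /eqP eV.
have := Ft eF fF; rewrite leqNgt => /negP; apply.
apply: leq_ltn_trans fS; apply: subset_leq_card.
apply/subsetP => i; rewrite fE !(in_setI, in_setD1, in_setU) => /andP[ie /andP[ij /orP[->|iV]]].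
  by rewrite ij.
by have : i \in e :&: V; [rewrite in_setI ie|rewrite eV inE].
Qed.

(** An edge outside the star family contains S and no petal, or does not contain S, or contains S
    and two petals. The first two kinds contain no (t+1)-cover, so branching applies; the third
    contains a set of size t + 2 at once. *)
Lemma covered_few_petals : #|V| <= k - t ->
  covered F t.+2 (2 ^ k * k ^ 2) (fun e => e \notin star_family k S V).
Proof.
move=> Vk.
have Vk' : #|V| <= k by lia.
have c1 : covered F t.+2 (k ^ 2)
    (fun e => S \subset e /\ [disjoint e & V]).
  apply: covered_avoiding; rewrite ?St// => T e Tt Tc eF eV Te.
  have [v vV TE] := cover_petals Tt Tc.
  have := disjointFl eV vV; rewrite (subsetP Te)// TE.
  by rewrite inE set11.
have c2 : covered F t.+2 (k * k ^ 2) (fun e => ~~ (S \subset e)).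
  apply: (@covered_bigU _ (enum S) _ _ _ _ _
    (fun j e => S :\ j :|: V \subset e /\ (j \in S /\ j \notin e))).
  - by rewrite -cardE St; lia.
  (* A (t+1)-cover contains S and so j, which e avoids. The starting set has t - 1 + |V| >= t
     elements because there is a petal. *)
  - move=> j; rewrite mem_enum => jS; apply: covered_avoiding.
      move=> T e Tt Tc eF [_ je] Te; move: je; apply/negP; rewrite negbK.
      exact: (subsetP Te) (subsetP (SC Tt Tc) _ jS).
    by rewrite card_petals_union//; have := petals_gt0; lia.
  by move=> e eF /(not_center eF)[j [jS je jVe]]; exists j; rewrite ?mem_enum.
have c3 : covered F t.+2 (k * (k * 1)) (fun e => exists v w,
    [/\ v \in V, w \in V, v != w & v |: (w |: S) \subset e]).
  apply: (@covered_bigU _ (enum V) _ _ _ _ _ (fun v e => exists w,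
    [/\ v \in V, w \in V, v != w & v |: (w |: S) \subset e])).
  - by rewrite -cardE.
  - move=> v; rewrite mem_enum => vV.
    apply: (@covered_bigU _ (enum V) _ _ _ _ _ (fun w e =>
      [/\ v \in V, w \in V, v != w & v |: (w |: S) \subset e])).
    + by rewrite -cardE.
    + move=> w; rewrite mem_enum => wV.
      have [->|vw] := eqVneq v w; first by apply: covered0 => e _ [_ _ /eqP].
      apply: (covered_superset (U := v |: (w |: S))); last by move=> e _ [].
      rewrite !cardsU1 !(in_setU, in_set1) (negbTE vw) St.
      by rewrite !(disjointFl disjoint_petals).
    + by move=> e eF [w [? wV ? ?]]; exists w; rewrite ?mem_enum.
  by move=> e eF [v [w [? ? ? ?]]]; exists v; rewrite ?mem_enum//; exists w.
apply: (coveredW _ _ (coveredU c1 (coveredU c2 c3))).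
  (* The total is k^2 + (k^3 + k^2) = (k + 2) k^2, and k + 2 <= 2^k for k >= 3. *)
  rewrite muln1 mulnn -mulSnr -mulSn leq_mul2r; apply/orP; right.
  have k3 : 2 < k by lia.
  rewrite -(subnK k3); elim: (k - 3) => // j IH.
  rewrite [j.+1 + 3]addSn expnS; lia.
move=> e eF; rewrite inE Fk// eqxx/= => eV.
have [Se|Se] := boolP (S \subset e); last by right; left.
have [eV0|] := boolP [disjoint e & V]; first by left.
rewrite -setI_eq0 => /set0Pn[v]; rewrite in_setI => /andP[ve vV].
right; right; exists v.
have /subsetPn[w] : ~~ (e :&: (S :|: V) \subset v |: S).
  apply: contra eV => eVS; apply/imsetP; exists v => //.
  apply/eqP; rewrite eqEsubset eVS/= subUset sub1set in_setI in_setU ve vV orbT/=.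
  by rewrite subsetI Se subsetUl.
rewrite in_setI !in_setU in_set1 negb_or => /andP[we wSV] /andP[wv wS].
move: wSV; rewrite (negbTE wS)/= => wV; exists w; split => //.
  by rewrite eq_sym.
by rewrite !subUset !sub1set ve we.
Qed.

End Sunflower.
End Family.
End Structure.

(** * The three types of maximal families *)

Section MaximalFamilies.
Import mathcomp.boot.fintype mathcomp.boot.finset.
Local Open Scope nat_scope.
Context {n : nat}.
Variables (k t : nat) (F : {set {set 'I_n}}).
Hypothesis Fnt : nontrivial_tintersecting k t F.
Hypothesis Fmax : forall G, nontrivial_tintersecting k t G -> F \subset G -> F = G.
Hypotheses (t0 : 0 < t) (tk : t.+1 < k) (kn : 3 * k <= n).

(** Adding K to F keeps the family t-intersecting and nontrivial, so by maximality K is already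
    there. *)
Lemma cover_superset_in (T K : {set 'I_n}) :
  is_cover t F T -> #|K| = k -> T \subset K -> K \in F.
Proof.
case: Fnt => Fk Ft Fn Tc Kk TK.
have KF e : e \in F -> t <= #|e :&: K|.
  by move=> /Tc /leq_trans; apply; exact: subset_leq_card (setIS _ TK).
have FG : F \subset K |: F by exact: subsetUr.
rewrite (Fmax _ FG) ?setU11//; split.
- by move=> e; rewrite in_setU1 => /predU1P[->//|/Fk].
- move=> e f; rewrite !in_setU1 => /predU1P[->|eF] /predU1P[->|fF].
  + by rewrite setIid Kk; lia.
  + by rewrite setIC KF.
  + exact: KF.
  + exact: Ft.
- by move=> [T' T't GT']; apply: Fn; exists T' => //; exact: subset_trans GT'.
Qed.

(** There is room to extend T to a k-set by vertices outside T'. It is an edge by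
    [cover_superset_in], and T' meets it only inside T. *)
Lemma covers_meet (T T' : {set 'I_n}) : #|T| = t.+1 -> #|T'| = t.+1 ->
  is_cover t F T -> is_cover t F T' -> t <= #|T :&: T'|.
Proof.
move=> Tt T't Tc T'c.
have [|A] := @exists_subset_card _ (~: (T :|: T')) (k - t.+1).
  have := cardsC (T :|: T'); have := cardsU T T'.
  by rewrite Tt T't card_ord; lia.
rewrite subsetC => TA Ak.
have TA0 : T :&: A = set0.
  apply/eqP; rewrite setI_eq0 disjoints_subset.
  exact: subset_trans (subsetUl _ _) TA.
have KF : T :|: A \in F.
  apply: cover_superset_in Tc _ (subsetUl _ _).
  by rewrite cardsU TA0 cards0 Tt Ak; lia.
have -> : T :&: T' = (T :|: A) :&: T'.
  rewrite setIUl [A :&: T']setIC; suff -> : T' :&: A = set0 by rewrite setU0.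
  apply/eqP; rewrite setI_eq0 disjoints_subset.
  exact: subset_trans (subsetUr _ _) TA.
exact: T'c.
Qed.

(** T3 meets T1 and T2 in t elements each but their intersection in fewer, so T3 lies inside Y, the
    union of T1 and T2. An edge with at most t elements in Y has its whole trace on Y inside each of
    the three covers, hence inside their common part, which has fewer than t elements. *)
Lemma sub_Aset (T1 T2 T3 : {set 'I_n}) :
  #|T1| = t.+1 -> #|T2| = t.+1 -> #|T3| = t.+1 ->
  is_cover t F T1 -> is_cover t F T2 -> is_cover t F T3 ->
  T1 != T2 -> ~~ (T1 :&: T2 \subset T3) ->
  #|T1 :|: T2| = t.+2 /\ F \subset Aset k t (T1 :|: T2).
Proof.
move=> T1t T2t T3t T1c T2c T3c T12 ST3.
have Fk : kgraph k F by case: Fnt.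
have St : #|T1 :&: T2| = t.
  apply/eqP; rewrite eqn_leq covers_meet// andbT -ltnS -T1t.
  rewrite ltn_neqAle subset_leq_card ?subsetIl// andbT.
  apply: contra T12 => /eqP T12E.
  have /eqP/setIidPl T1T2 : T1 :&: T2 == T1 by rewrite eqEcard subsetIl T12E leqnn.
  by rewrite eqEcard T1T2 T1t T2t/=.
have Yt : #|T1 :|: T2| = t.+2 by rewrite cardsU St T1t T2t; lia.
split=> //; apply/subsetP => e eF; rewrite inE Fk// eqxx/= ltnNge.
apply/negP => eY.
set Y := T1 :|: T2 in Yt eY *.
have T3S : #|T3 :&: (T1 :&: T2)| < t.
  rewrite -St ltn_neqAle subset_leq_card ?subsetIr// andbT.
  apply: contra ST3 => /eqP E; apply/setIidPr/eqP.
  by rewrite eqEcard subsetIr E leqnn.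
have T3Y : T3 \subset Y.
  have M1 := covers_meet T3t T1t T3c T1c.
  have M2 := covers_meet T3t T2t T3c T2c.
  have := cardsU (T3 :&: T1) (T3 :&: T2).
  rewrite -setIUr setIACA setIid => E.
  have M3 : #|T3 :&: (T1 :&: T2)| <= #|T3 :&: T1|.
    by rewrite subset_leq_card// setIS// subsetIl.
  apply/setIidPl/eqP; rewrite eqEcard subsetIl T3t /Y E; lia.
have eYE (T : {set 'I_n}) : T \subset Y -> is_cover t F T -> e :&: Y \subset T.
  move=> TY /(_ e eF) eT.
  suff /eqP <- : e :&: T == e :&: Y by exact: subsetIr.
  by rewrite eqEcard setIS//=; exact: leq_trans eT.
have : e :&: Y \subset T3 :&: (T1 :&: T2).
  by rewrite !subsetI !eYE ?subsetUl ?subsetUr.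
move=> /subset_leq_card; rewrite leqNgt => /negP; apply.
apply: leq_trans T3S _.
apply: leq_trans (T1c _ eF) _; apply: subset_leq_card; apply: setIS.
exact: subsetUl.
Qed.

Lemma maximal_structure :
  [\/ exists2 Y : {set 'I_n}, #|Y| = t.+2 & F \subset Aset k t Y,
      exists S V : {set 'I_n}, [/\ [disjoint S & V], #|S| = t,
        #|V| = (k - t).+1 & F \subset Hset k S V]
    | exists S V : {set 'I_n}, [/\ [disjoint S & V], #|S| = t, #|V| <= k - t
        & covered F t.+2 (2 ^ k * k ^ 2) (fun e => e \notin star_family k S V)]].
Proof.
case: (Fnt) => Fk Ft Fn.
have [[T1 [T1t T1c]]|noT] := pselect (exists T : {set 'I_n},
    #|T| = t.+1 /\ is_cover t F T); last first.
  (* Without covers V is taken empty: the star family is then empty and all of F is covered by sets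
     of size t + 2. *)
  have [S _ St] : exists2 S : {set 'I_n}, S \subset setT & #|S| = t.
    by apply: exists_subset_card; rewrite cardsT card_ord; lia.
  have [e0 e0F _] := is_coverPn (tset_noncover Fk Fn St).
  apply: Or33; exists S, set0; rewrite cards0; split => //.
    by rewrite disjoint_sym disjoints_subset sub0set.
  apply: coveredW (covered_no_cover Fk Ft Fn tk e0F _) => // T Tt Tc.
  by apply: noT; exists T.
have sunflower (S : {set 'I_n}) : #|S| = t ->
    (forall T : {set 'I_n}, #|T| = t.+1 -> is_cover t F T -> S \subset T) ->
    [\/ exists2 Y : {set 'I_n}, #|Y| = t.+2 & F \subset Aset k t Y,
      exists S V : {set 'I_n}, [/\ [disjoint S & V], #|S| = t,
        #|V| = (k - t).+1 & F \subset Hset k S V]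
    | exists S V : {set 'I_n}, [/\ [disjoint S & V], #|S| = t, #|V| <= k - t
        & covered F t.+2 (2 ^ k * k ^ 2) (fun e => e \notin star_family k S V)]].
  move=> St SC.
  have exC : exists2 T : {set 'I_n}, #|T| = t.+1 & is_cover t F T by exists T1.
  have := card_petals Fk Fn tk St t0 SC exC; rewrite leq_eqVlt => /orP[/eqP VE|Vlt].
    apply: Or32; exists S, (petals t F S); split => //; first exact: disjoint_petals.
    exact: sub_Hset.
  apply: Or33; exists S, (petals t F S); split => //; first exact: disjoint_petals.
  exact: covered_few_petals.
have [[T2 [T2t T2c T12]]|noT2] := pselect (exists T : {set 'I_n},
    [/\ #|T| = t.+1, is_cover t F T & T1 != T]); last first.
  (* T1 is the only cover of size t + 1, so any t-subset of it can serve as S. *)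
  have [S ST1 St] : exists2 S : {set 'I_n}, S \subset T1 & #|S| = t.
    by apply: exists_subset_card; rewrite T1t.
  apply: (sunflower S St) => T Tt Tc.
  have [<-//|T1T] := eqVneq T1 T.
  by case: noT2; exists T.
have [T3h|noT3] := pselect (forall T : {set 'I_n}, #|T| = t.+1 ->
    is_cover t F T -> T1 :&: T2 \subset T).
  apply: (sunflower (T1 :&: T2)) => //.
  apply/eqP; rewrite eqn_leq covers_meet// andbT -ltnS -T1t.
  rewrite ltn_neqAle subset_leq_card ?subsetIl// andbT.
  apply: contra T12 => /eqP T12E.
  have /eqP/setIidPl T1T2 : T1 :&: T2 == T1 by rewrite eqEcard subsetIl T12E leqnn.
  by rewrite eqEcard T1T2 T1t T2t/=.
move/existsNP: noT3 => [T3 /not_implyP[T3t /not_implyP[T3c /negP ST3]]].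
have [Yt FY] := sub_Aset T1t T2t T3t T1c T2c T3c T12 ST3.
by apply: Or31; exists (T1 :|: T2).
Qed.

End MaximalFamilies.

Section Maximalize.
Import mathcomp.boot.fintype mathcomp.boot.finset.
Context {n : nat}.

Lemma exists_maximal k t (F : {set {set 'I_n}}) : nontrivial_tintersecting k t F ->
  exists F', [/\ nontrivial_tintersecting k t F', F \subset F' &
    forall G, nontrivial_tintersecting k t G -> F' \subset G -> F' = G].
Proof.
move=> Fnt.
pose p (G : {set {set 'I_n}}) := `[< nontrivial_tintersecting k t G >].
have pF : p F by exact/asboolP.
have [F' /maxsetP[/asboolP F'nt F'max] FF'] := maxset_exists (P := p) pF.
exists F'; split=> // G Gnt F'G.
by apply/esym/F'max => //; exact/asboolP.
Qed.

End Maximalize.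

(** * Uniqueness *)

Section Strictness.
Local Open Scope ring_scope.
Context {R : realType} {n : nat}.
Implicit Types (F G : {set {set 'I_n}}) (k : nat).

Lemma edge_poly_le_rho k G (y : 'I_n -> R) : (0 < k)%N -> kgraph k G ->
  (forall i, 0 <= y i) ->
  k%:R * edge_poly G y <= rho R k G * \sum_i y i ^+ k.
Proof.
move=> k0 Gk y0; set s := \sum_i _.
have k0R : 0 < k%:R :> R by rewrite ltr0n.
have s_ge0 : 0 <= s by apply: sumr_ge0 => i _; exact: exprn_ge0.
have [s0|s0] := eqVneq s 0.
  rewrite s0 mulr0 /edge_poly big1 ?mulr0// => e /Gk ek.
  have /finset.set0Pn[i ie] : e != finset.set0 by rewrite -finset.card_gt0 ek.
  rewrite (bigD1 i)//= (_ : y i = 0) ?mul0r//; apply/eqP.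
  have : y i ^+ k == 0.
    move/eqP: s0; rewrite psumr_eq0 => [/allP/(_ i)|j _]; last exact: exprn_ge0.
    by rewrite mem_index_enum => /(_ isT).
  by rewrite expf_eq0 k0.
have sgt0 : 0 < s by rewrite lt_def s0.
pose z i := y i * rt k (k%:R / s).
have ks0 : 0 < k%:R / s by rewrite divr_gt0.
have z0 i : 0 <= z i by rewrite mulr_ge0 ?rt_ge0.
have zk : \sum_i z i ^+ k = k%:R.
  under eq_bigr => i _ do rewrite exprMn rtX ?(ltW ks0)//.
  by rewrite -big_distrl/= mulrCA mulfV ?mulr1.
have := rho_ge k0 z0 zk Gk.
have -> : edge_poly G z = edge_poly G y * (k%:R / s).
  rewrite /edge_poly big_distrl/=; apply: eq_bigr => e /Gk ek.
  by rewrite big_split/= prodr_const ek rtX// ltW.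
by rewrite mulrA ler_pdivrMr// mulrC.
Qed.

(* A maximiser for F is one for G. It has no zero coordinate: raising its zero
   coordinates to eps gains a term of order eps ^ r for an edge with r < k of
   them, and increases the sum of the k-th powers by O(eps ^ k) only. *)
Lemma rho_strict k F G : (0 < n)%N -> (0 < k)%N -> kgraph k G ->
  (forall e f, e \in G -> f \in G -> e :&: f != finset.set0) ->
  (forall i, exists2 e, e \in G & i \in e) ->
  F \subset G -> rho R k F = rho R k G -> F = G.
Proof.
move=> n0 k0 Gk Gmeet Gcov FG rhoE.
have k0R : 0 < k%:R :> R by rewrite ltr0n.
have [x [[x0 xk] rhoF _]] := rho_max R F n0 k0.
have FGx := edge_polyS x0 FG.
have := edge_poly_le_rho k0 Gk x0; rewrite xk mulr1 -rhoE rhoF ler_pM2l// => GFx.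
have {GFx FGx} PE : edge_poly F x = edge_poly G x by apply: le_anti; rewrite FGx.
set M := edge_poly G x in PE.
have rhoM : rho R k G = k%:R * M by rewrite -rhoE rhoF PE.
have M0 : 0 <= M by exact: edge_poly_ge0.
have hom (y : 'I_n -> R) : (forall i, 0 <= y i) -> edge_poly G y <= M * \sum_i y i ^+ k.
  move=> y0; rewrite -(ler_pM2l k0R) mulrA -rhoM; exact: edge_poly_le_rho.
have Mgt0 : 0 < M.
  rewrite lt_def M0 andbT; apply/eqP => ME0.
  have := hom (fun=> 1) (fun=> ler01); rewrite ME0 mul0r leNgt => /negP; apply.
  have [e eG _] := Gcov (Ordinal n0).
  rewrite /edge_poly (bigD1 e)//= big1 ?ltr_wpDr ?ltr01//.
  by apply: sumr_ge0 => f _; apply: prodr_ge0.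
have [e0 e0G e0x] : exists2 e0, e0 \in G & forall i, i \in e0 -> 0 < x i.
  have [//|/forall_inPn] := boolP [forall e in G, \prod_(i in e) x i == 0].
    move=> /forall_inP G0; move: Mgt0; rewrite /M /edge_poly big1 ?ltxx// => e.
    by move=> /G0/eqP.
  move=> [e eG /prodf_neq0 ex]; exists e => // i ie.
  by rewrite lt_def x0 andbT; exact: ex.
have xpos i : 0 < x i.
  rewrite lt_def x0 andbT; apply/negP => /eqP xi0.
  have [e eG ie] := Gcov i.
  (* The edge e0 lies in the support of x and e meets it, so not all vertices of e have coordinate
     zero; this yields r < k. *)
  have /finset.set0Pn[j] := Gmeet _ _ eG e0G.
  rewrite finset.in_setI => /andP[je je0].
  pose Z := [set l | x l == 0]%SET.
  pose c := \prod_(l in e | l \notin Z) x l.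
  have c0 : 0 < c.
    apply: prodr_gt0 => l /andP[_]; rewrite finset.inE => xl0.
    by rewrite lt_def xl0 x0.
  have d0 : 0 < M * #|Z|%:R + c by rewrite ltr_wpDl// mulr_ge0.
  (* Chosen so that eps <= 1 and M * |Z| * eps < c: the gain c eps^r then exceeds the loss M |Z|
     eps^k, because k >= r + 1. *)
  pose eps := c / (M * #|Z|%:R + c).
  have eps0 : 0 < eps by rewrite divr_gt0.
  have eps1 : eps <= 1 by rewrite ler_pdivrMr// mul1r lerDr mulr_ge0.
  pose y l := if l \in Z then eps else x l.
  have yZ l : l \notin Z -> y l = x l by rewrite /y => /negbTE ->.
  have y0 l : 0 <= y l by rewrite /y; case: ifP => // _; exact: ltW.
  have xy l : x l <= y l.
    by rewrite /y; case: ifP => //; rewrite finset.inE => /eqP ->; exact: ltW.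
  have yk : \sum_l y l ^+ k = 1 + #|Z|%:R * eps ^+ k.
    rewrite (bigID (mem Z))/= addrC; congr (_ + _).
      rewrite -xk [RHS](bigID (mem Z))/= [X in _ = X + _]big1 ?add0r => [|l].
        by apply: eq_bigr => l /yZ ->.
      by rewrite finset.inE => /eqP ->; rewrite expr0n gtn_eqF.
    rewrite (eq_bigr (fun=> eps ^+ k)) => [|l lZ]; last by rewrite /y lZ.
    by rewrite sumr_const mulr_natl.
  have jZ : j \notin Z by rewrite finset.inE gt_eqF// e0x.
  have iZ : i \in Z by rewrite finset.inE xi0.
  pose r := #|e :&: Z|%SET.
  have rk : (r < k)%N.
    rewrite -(Gk _ eG) proper_card//; apply/fintype.properP; split.
      exact: finset.subsetIl.
    by exists j; rewrite // finset.in_setI (negbTE jZ) andbF.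
  have ey : \prod_(l in e) y l = eps ^+ r * c.
    rewrite (bigID (mem Z))/=; congr (_ * _).
      rewrite -(@prodr_const _ _ (mem (e :&: Z)%SET)); apply: eq_big => l.
        by rewrite finset.in_setI.
      by move=> /andP[_ lZ]; rewrite /y lZ.
    by apply: eq_bigr => l /andP[_ /yZ].
  have ex : \prod_(l in e) x l = 0 by rewrite (bigD1 i)//= xi0 mul0r.
  have My : M + eps ^+ r * c <= edge_poly G y.
    rewrite /M /edge_poly !(bigD1 e eG)/= ex ey add0r [leLHS]addrC lerD2l.
    apply: ler_sum => f _; apply: ler_prod => l _; by rewrite x0 xy.
  have := le_trans My (hom y y0); rewrite yk mulrDr mulr1 lerD2l.
  have -> : M * (#|Z|%:R * eps ^+ k)
      = eps ^+ r * (M * #|Z|%:R * eps * eps ^+ (k - r.+1)).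
    by rewrite -{1}(subnKC rk) exprD exprSr; ring.
  rewrite ler_pM2l ?exprn_gt0// leNgt => /negP; apply.
  apply: (@le_lt_trans _ _ (M * #|Z|%:R * eps)).
    apply: ler_piMr; last by apply: exprn_ile1 => //; exact: ltW.
    by apply: mulr_ge0; [exact: mulr_ge0|exact: ltW].
  rewrite /eps mulrA ltr_pdivrMr// mulrC ltr_pM2l//.
  by rewrite ltrDl.
apply/eqP; rewrite finset.eqEsubset FG/=; apply/fintype.subsetP => e eG.
apply/negPn/negP => eF.
have : edge_poly F x < edge_poly G x; last by rewrite PE ltxx.
apply: (@lt_le_trans _ _ (edge_poly F x + \prod_(i in e) x i)).
  by rewrite ltrDl prodr_gt0.
apply: (@le_trans _ _ (edge_poly (e |: F)%SET x)).
  by rewrite /edge_poly big_setU1//= addrC.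
by apply: edge_polyS => //; rewrite finset.subUset finset.sub1set eG FG.
Qed.

End Strictness.

(** * The candidate families *)

Section Candidates.
Import mathcomp.boot.fintype mathcomp.boot.finset.
Local Open Scope nat_scope.
Context {n : nat}.
Implicit Types (k t : nat) (S T U V W Y : {set 'I_n}) (F G : {set {set 'I_n}}).

(** Each vertex is sent to its position in the list of S, then V, then the remaining vertices. *)
Lemma exists_perm_seg S V : [disjoint S & V] -> exists s : {perm 'I_n},
  s @: S = seg n 1 #|S| /\ s @: V = seg n #|S|.+1 (#|S| + #|V|).
Proof.
move=> dSV; pose q := enum S ++ enum V ++ enum (~: (S :|: V)).
have qE i : i \in q.
  by rewrite !mem_cat !mem_enum !inE; case: (i \in S); case: (i \in V).
have szq : size q = n.
  rewrite !size_cat -!cardE addnA.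
  have -> : #|S| + #|V| = #|S :|: V| by rewrite cardsU disjoint_setI0// cards0 subn0.
  by rewrite cardsC card_ord.
have qlt i : index i q < n by rewrite -[ltnRHS]szq index_mem.
pose f i := Ordinal (qlt i).
have f_inj : injective f.
  move=> i j /(congr1 val)/= ij.
  by rewrite -(nth_index i (qE i)) ij nth_index.
have fS i : (f i < #|S|) = (i \in S).
  rewrite /= index_cat mem_enum; case: ifP => iS.
    by rewrite cardE index_mem mem_enum.
  by rewrite -cardE ltnNge leq_addr.
have fV i : (#|S| <= f i < #|S| + #|V|) = (i \in V).
  rewrite leqNgt fS; case: (boolP (i \in S)) => iS /=.
    by rewrite (disjointFr dSV iS).
  rewrite index_cat mem_enum (negbTE iS) -cardE ltn_add2l index_cat mem_enum.
  case: ifP => iV; first by rewrite [ltnRHS]cardE index_mem mem_enum.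
  by rewrite -cardE ltnNge leq_addr.
exists (perm f_inj); split; apply/setP => j.
  rewrite -[j](permKV (perm f_inj)) mem_imset; last exact: perm_inj.
  by rewrite -fS inE -(permE f_inj)/= permKV.
rewrite -[j](permKV (perm f_inj)) mem_imset; last exact: perm_inj.
by rewrite -fV inE -(permE f_inj)/= permKV ltnS.
Qed.

(** The segments are images under [exists_perm_seg] of disjoint sets of sizes a and b, so no
    counting in ordinals is involved. *)
Lemma card_seg a b : a + b <= n ->
  #|seg n 1 a| = a /\ #|seg n a.+1 (a + b)| = b.
Proof.
move=> abn.
have [S _ Sa] : exists2 S : {set 'I_n}, S \subset setT & #|S| = a.
  by apply: exists_subset_card; rewrite cardsT card_ord; lia.
have [V VS Vb] : exists2 V : {set 'I_n}, V \subset ~: S & #|V| = b.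
  by apply: exists_subset_card; have := cardsC S; rewrite card_ord; lia.
have dSV : [disjoint S & V] by rewrite disjoint_sym disjoints_subset.
have [s [sS sV]] := exists_perm_seg dSV.
rewrite -{1}Sa -sS -[in seg _ _.+1 _]Sa -[in seg _ _ _]Vb -sV.
by rewrite !card_imset//; exact: perm_inj.
Qed.

Lemma disjoint_seg a b : [disjoint seg n 1 a & seg n a.+1 b].
Proof.
rewrite -setI_eq0; apply/eqP/setP => i; rewrite !inE.
by apply/negbTE/negP; lia.
Qed.

Lemma AfamE k t : Afam n k t = Aset k t (seg n 1 t.+2).
Proof. by []. Qed.

Lemma HfamE k t : t <= k -> Hfam n k t = Hset k (seg n 1 t) (seg n t.+1 k.+1).
Proof.
move=> tk; rewrite /Hfam /Hset; congr (_ :|: _).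
suff -> : seg n 1 t :|: seg n t.+1 k.+1 = seg n 1 k.+1 by [].
by apply/setP => i; rewrite !inE; apply/idP/idP; lia.
Qed.

Lemma imset_Aset k t Y (s : {perm 'I_n}) F : F \subset Aset k t Y ->
  [set s @: e | e : {set 'I_n} in F] \subset Aset k t (s @: Y).
Proof.
move=> /subsetP FA; apply/subsetP => _ /imsetP[e /FA eA ->]; move: eA.
rewrite !inE -imsetI; last by move=> i j _ _; exact: perm_inj.
by rewrite !card_imset//; exact: perm_inj.
Qed.

Lemma imset_Hset k S V (s : {perm 'I_n}) F : F \subset Hset k S V ->
  [set s @: e | e : {set 'I_n} in F] \subset Hset k (s @: S) (s @: V).
Proof.
move=> /subsetP FH; apply/subsetP => _ /imsetP[e /FH eH ->]; move: eH.
rewrite /Hset !in_setU => /orP[|/imsetP[j jS ->]].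
  rewrite !inE => /and3P[ek Se /set0Pn[v]]; rewrite inE => /andP[ve vV].
  apply/orP; left; rewrite card_imset ?ek ?imsetS//=; last exact: perm_inj.
  by apply/set0Pn; exists (s v); rewrite inE !imset_f.
apply/orP; right; apply/imsetP; exists (s j); first exact: imset_f.
rewrite -imsetU !setDE imsetI; last by move=> a b _ _; exact: perm_inj.
congr (_ :&: _); apply/setP => i; rewrite !inE.
apply/imsetP/idP => [[l]|ij].
  by rewrite !inE => lj ->; rewrite (inj_eq perm_inj).
exists ((s^-1)%g i); last by rewrite permKV.
by rewrite !inE; apply: contra ij => /eqP <-; rewrite permKV.
Qed.

Lemma exists_edge k U W : #|U| <= k -> k + #|W| <= n -> [disjoint U & W] ->
  exists e : {set 'I_n}, [/\ #|e| = k, U \subset e & [disjoint e & W]].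
Proof.
move=> Uk kW dUW.
have [|A] := @exists_subset_card n (~: (U :|: W)) (k - #|U|).
  have := cardsC (U :|: W); rewrite cardsU disjoint_setI0// cards0 card_ord; lia.
rewrite subsetC => UWA Ak.
have UA : U :&: A = set0.
  apply/eqP; rewrite setI_eq0 disjoints_subset.
  exact: subset_trans (subsetUl _ _) UWA.
have WA : W :&: A = set0.
  apply/eqP; rewrite setI_eq0 disjoints_subset.
  exact: subset_trans (subsetUr _ _) UWA.
exists (U :|: A); split; last 2 first.
- exact: subsetUl.
- by rewrite -setI_eq0 setIUl disjoint_setI0// set0U setIC WA.
by rewrite cardsU UA cards0 Ak; lia.
Qed.

Section Aprops.
Variables (k t : nat) (Y : {set 'I_n}).
Hypothesis Yt : #|Y| = t.+2.

Lemma kgraph_Aset : kgraph k (Aset k t Y).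
Proof. by move=> e; rewrite inE => /andP[/eqP]. Qed.

Lemma tintersecting_Aset : tintersecting t (Aset k t Y).
Proof.
move=> e f; rewrite !inE => /andP[_ eY] /andP[_ fY].
have := cardsU (e :&: Y) (f :&: Y).
have : #|(e :&: Y) :|: (f :&: Y)| <= #|Y|.
  by rewrite subset_leq_card// subUset !subsetIr.
have : #|(e :&: Y) :&: (f :&: Y)| <= #|e :&: f|.
  by rewrite subset_leq_card// setIACA setIid subsetIl.
have := subset_leq_card (subsetIl (e :&: Y) (f :&: Y)).
rewrite Yt; lia.
Qed.

Hypotheses (tk : t.+1 < k) (kn : k < n).

Lemma Aset_cover i : exists2 e, e \in Aset k t Y & i \in e.
Proof.
have [B BY Bt] : exists2 B : {set 'I_n}, B \subset Y & #|B| = t.+1.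
  by apply: exists_subset_card; rewrite Yt.
have [|||e [ek ie _]] := @exists_edge k (i |: B) set0.
- by rewrite cardsU1 Bt; case: (i \notin B); lia.
- by rewrite cards0; lia.
- by rewrite disjoint_sym disjoints_subset sub0set.
exists e; last by apply: (subsetP ie); rewrite setU11.
rewrite inE ek eqxx/= -Bt subset_leq_card// subsetI BY andbT.
exact: subset_trans (subsetUr _ _) ie.
Qed.

(** Since no vertex is common to all edges, a nonempty center is impossible; this is the source of
    nontriviality. *)
Lemma Aset_avoid i : exists2 e, e \in Aset k t Y & i \notin e.
Proof.
have [B BY Bt] : exists2 B : {set 'I_n}, B \subset Y :\ i & #|B| = t.+1.
  apply: exists_subset_card; have := cardsD1 i Y; rewrite Yt.
  by case: (i \in Y); lia.
have /andP[BY' Bi] : (B \subset Y) && (i \notin B).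
  by move: BY; rewrite subsetD1.
have [|||e [ek Be ei]] := @exists_edge k B [set i].
- by rewrite Bt; lia.
- by rewrite cards1; lia.
- by rewrite disjoints_subset subsetC sub1set inE.
exists e; last by rewrite (disjointFl ei)// inE.
by rewrite inE ek eqxx/= -Bt subset_leq_card// subsetI BY' Be.
Qed.

Lemma nontrivial_Aset : 0 < t -> nontrivial_tintersecting k t (Aset k t Y).
Proof.
move=> t0; split; [exact: kgraph_Aset|exact: tintersecting_Aset|].
move=> [T Tt /subsetP AT].
have /set0Pn[j jT] : T != set0 by rewrite -card_gt0 Tt.
have [e /AT] := Aset_avoid j; rewrite inE => /andP[_ /subsetP/(_ j jT)] je.
by rewrite je.
Qed.

End Aprops.

Section Hprops.
Variables (k t : nat) (S V : {set 'I_n}).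
Hypotheses (dSV : [disjoint S & V]) (St : #|S| = t) (Vk : #|V| = (k - t).+1).
Hypothesis tk : t.+1 < k.

Lemma card_SV : #|S :|: V| = k.+1.
Proof. by rewrite cardsU disjoint_setI0// cards0 St Vk; lia. Qed.

Lemma kgraph_Hset : kgraph k (Hset k S V).
Proof.
move=> e; rewrite in_setU => /orP[|/imsetP[j jS ->]].
  by rewrite inE => /and3P[/eqP].
have := cardsD1 j (S :|: V); rewrite card_SV in_setU jS add1n => -[].
by [].
Qed.

(** An edge through S and v in V meets [(S :|: V) :\ j] in S without j, together with v. Two sets of
    the second kind share at least k + 1 - 2 >= t elements. *)
Lemma tintersecting_Hset : tintersecting t (Hset k S V).
Proof.
have H e j : e \in Hset k S V -> S \subset e -> e :&: V != set0 -> j \in S ->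
    t <= #|e :&: ((S :|: V) :\ j)|.
  move=> eH Se /set0Pn[v]; rewrite in_setI => /andP[ve vV] jS.
  have vS := disjointFl dSV vV.
  have <- : #|v |: S :\ j| = t.
    by rewrite cardsU1 in_setD1 vS andbF/= -St (cardsD1 j S) jS.
  apply: subset_leq_card; rewrite subUset sub1set !(in_setI, in_setD1, in_setU).
  rewrite ve vS vV/= andbT; apply/andP; split.
    by apply: contraTneq jS => <-; rewrite vS.
  rewrite subsetI (subset_trans (subD1set _ _) Se)/=.
  by apply: setSD; exact: subsetUl.
move=> e f eH fH; move: (eH) (fH); rewrite !in_setU.
move=> /orP[eS|/imsetP[j jS eE]] /orP[fS|/imsetP[i iS fE]].
- move: eS fS; rewrite !inE => /and3P[_ Se _] /and3P[_ Sf _].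
  by rewrite -St subset_leq_card// subsetI Se.
- by move: eS; rewrite inE fE => /and3P[_ Se Ve]; exact: H.
- by move: fS; rewrite inE eE [_ :&: f]setIC => /and3P[_ Sf Vf]; exact: H.
- have -> : e :&: f = (S :|: V) :\: [set j; i].
    by rewrite eE fE !setDE -setIIr -setCU.
  have := cardsD (S :|: V) [set j; i]; rewrite card_SV => ->.
  have := subset_leq_card (subsetIr (S :|: V) [set j; i]).
  by rewrite cards2; case: (j != i) => /=; lia.
Qed.

Lemma star_sub_Hset : star_family k S V \subset Hset k S V.
Proof.
apply/subsetP => e; rewrite inE => /andP[ek /imsetP[v vV eE]].
have : v |: S \subset e by rewrite -eE subsetIl.
rewrite subUset sub1set => /andP[ve Se].
rewrite in_setU inE ek Se/=; apply/orP; left; apply/set0Pn; exists v.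
by rewrite inE ve.
Qed.

Lemma mem_Hset (e : {set 'I_n}) v : #|e| = k -> S \subset e -> v \in V -> v \in e ->
  e \in Hset k S V.
Proof.
move=> ek Se vV ve; rewrite in_setU inE ek eqxx Se/=.
by apply/orP; left; apply/set0Pn; exists v; rewrite in_setI ve.
Qed.

Hypothesis kn : k < n.

Lemma exists_V_neq i : exists2 v, v \in V & v != i.
Proof.
have : 0 < #|V :\ i|.
  by have := cardsD1 i V; rewrite Vk; case: (i \in V) => /=; lia.
by rewrite card_gt0 => /set0Pn[v]; rewrite in_setD1 => /andP[vi vV]; exists v.
Qed.

Lemma Hset_cover i : exists2 e, e \in Hset k S V & i \in e.
Proof.
have [v vV _] := exists_V_neq i.
have [|||e [ek ie _]] := @exists_edge k (i |: (v |: S)) set0.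
- by rewrite !cardsU1 St; case: (i \notin _); case: (v \notin _) => /=; lia.
- by rewrite cards0; lia.
- by rewrite disjoint_sym disjoints_subset sub0set.
move: ie; rewrite !subUset !sub1set => /and3P[ie ve Se].
by exists e => //; exact: mem_Hset vV ve.
Qed.

Lemma Hset_avoid i : exists2 e, e \in Hset k S V & i \notin e.
Proof.
have [iS|iS] := boolP (i \in S).
  exists ((S :|: V) :\ i); last by rewrite in_setD1 eqxx.
  by rewrite in_setU; apply/orP; right; apply/imsetP; exists i.
have [v vV vi] := exists_V_neq i.
have [|||e [ek vSe ei]] := @exists_edge k (v |: S) [set i].
- by rewrite !cardsU1 St; case: (v \notin _) => /=; lia.
- by rewrite cards1; lia.
- by rewrite disjoint_sym disjoints_subset sub1set !inE negb_or eq_sym vi.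
exists e; last by rewrite (disjointFl ei)// inE.
move: vSe; rewrite !subUset !sub1set => /andP[ve Se].
exact: mem_Hset vV ve.
Qed.

Lemma nontrivial_Hset : 0 < t -> nontrivial_tintersecting k t (Hset k S V).
Proof.
move=> t0; split; [exact: kgraph_Hset|exact: tintersecting_Hset|].
move=> [T Tt /subsetP AT].
have /set0Pn[j jT] : T != set0 by rewrite -card_gt0 Tt.
have [e /AT] := Hset_avoid j; rewrite inE => /andP[_ /subsetP/(_ j jT)] je.
by rewrite je.
Qed.

End Hprops.

Lemma tintersecting_meet t F : 0 < t -> tintersecting t F ->
  forall e f, e \in F -> f \in F -> e :&: f != set0.
Proof.
by move=> t0 Ft e f eF fF; rewrite -card_gt0; exact: leq_trans t0 (Ft _ _ eF fF).
Qed.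

Lemma nontrivial_imset k t F (s : {perm 'I_n}) :
  nontrivial_tintersecting k t F ->
  nontrivial_tintersecting k t [set s @: e | e : {set 'I_n} in F].
Proof.
move=> [Fk Ft Fn]; split.
- by move=> _ /imsetP[e /Fk ek ->]; rewrite card_imset//; exact: perm_inj.
- move=> _ _ /imsetP[e eF ->] /imsetP[f fF ->].
  rewrite -imsetI; last by move=> i j _ _; exact: perm_inj.
  by rewrite card_imset ?Ft//; exact: perm_inj.
move=> [T Tt /subsetP FT]; apply: Fn; exists ((s^-1)%g @: T).
  by rewrite card_imset//; exact: perm_inj.
apply/subsetP => e eF; have := FT _ (imset_f (fun e : {set 'I_n} => s @: e) eF).
rewrite !inE card_imset; last exact: perm_inj.
move=> /andP[-> /= /subsetP Te]; apply/subsetP => _ /imsetP[i iT ->].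
by have /imsetP[j je ->] := Te _ iT; rewrite permK.
Qed.

Lemma isomorphic_sym F G : isomorphic F G -> isomorphic G F.
Proof.
move=> [s <-]; exists (s^-1)%g; apply/setP => e; apply/imsetP/idP.
  move=> [_ /imsetP[f fF ->] ->]; rewrite -imset_comp.
  by rewrite (eq_imset (g := id)) ?imset_id// => i /=; rewrite permK.
move=> eF; exists (s @: e); first exact: imset_f.
by rewrite -imset_comp (eq_imset (g := id)) ?imset_id// => i /=; rewrite permK.
Qed.

Lemma nontrivial_isomorphic k t F G : isomorphic F G ->
  nontrivial_tintersecting k t G -> nontrivial_tintersecting k t F.
Proof. by move=> /isomorphic_sym[s <-]; exact: nontrivial_imset. Qed.

End Candidates.

(** * The maximum and its equality cases *)

Section Extremality.
Context {R : realType}.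
Variables (k t n : nat).
Hypotheses (t0 : (0 < t)%N) (tk : (t.+1 < k)%N).
Hypothesis kn : (100 * 2 ^ k * k ^ 7 <= n)%N.
Local Notation A := (Afam n k t).
Local Notation H := (Hfam n k t).

Let kn3 : (3 * k <= n)%N.
Proof.
apply: leq_trans kn; have := leq_pmull (k ^ 7) (_ : 0 < 2 ^ k)%N.
rewrite !expn_gt0 => /(_ erefl).
have : (k ^ 1 <= k ^ 7)%N by rewrite leq_pexp2l//; lia.
nia.
Qed.

Let Hseg : [/\ [disjoint seg n 1 t & seg n t.+1 k.+1], #|seg n 1 t| = t
  & #|seg n t.+1 k.+1| = (k - t).+1].
Proof.
have [|St Vt] := @card_seg n t (k - t).+1; first lia.
split; [exact: disjoint_seg|exact: St|].
by move: Vt; rewrite (_ : t + (k - t).+1 = k.+1)%N//; lia.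
Qed.

Let Yt : #|seg n 1 t.+2| = t.+2.
Proof. by have [|//] := @card_seg n t.+2 0; lia. Qed.

Let HE : H = Hset k (seg n 1 t) (seg n t.+1 k.+1).
Proof. by apply: HfamE; lia. Qed.

Lemma nontrivial_Afam : nontrivial_tintersecting k t A.
Proof. by rewrite AfamE; apply: nontrivial_Aset => //; lia. Qed.

Lemma nontrivial_Hfam : nontrivial_tintersecting k t H.
Proof. by have [dSV St Vk] := Hseg; rewrite HE; apply: nontrivial_Hset => //; lia. Qed.

Lemma Afam_strict (F : {set {set 'I_n}}) : F \subset A -> rho R k F = rho R k A -> F = A.
Proof.
have [Ak At _] := nontrivial_Afam; apply: rho_strict => //; [lia|lia| |].
  exact: tintersecting_meet At.
by move=> i; rewrite AfamE; apply: Aset_cover => //; lia.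
Qed.

Lemma Hfam_strict (F : {set {set 'I_n}}) : F \subset H -> rho R k F = rho R k H -> F = H.
Proof.
have [Hk Ht _] := nontrivial_Hfam; apply: rho_strict => //; [lia|lia| |].
  exact: tintersecting_meet Ht.
by have [dSV St Vk] := Hseg => i; rewrite HE; apply: Hset_cover => //; lia.
Qed.

Lemma sub_candidate_or_lt (F : {set {set 'I_n}}) : nontrivial_tintersecting k t F ->
  [\/ exists s : {perm 'I_n}, [set s @: e | e : {set 'I_n} in F]%SET \subset A,
      exists s : {perm 'I_n}, [set s @: e | e : {set 'I_n} in F]%SET \subset H
    | rho R k F < rho R k H].
Proof.
move=> /exists_maximal[F' [F'nt FF' F'max]].
have [dSV0 St0 Vk0] := Hseg.
have tr (s : {perm 'I_n}) : [set s @: e | e : {set 'I_n} in F]%SET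
    \subset [set s @: e | e : {set 'I_n} in F']%SET by exact: finset.imsetS.
have [[Y Y2 F'A]|[S [V [dSV St Vk F'H]]]|[S [V [dSV St Vk [s [ss st sF]]]]]] :=
  maximal_structure F'nt F'max t0 tk kn3.
- have [|s [sY _]] := @exists_perm_seg n Y finset.set0.
    by rewrite disjoint_sym finset.disjoints_subset finset.sub0set.
  apply: Or31; exists s; apply: fintype.subset_trans (tr s) _.
  by have := imset_Aset s F'A; rewrite sY Y2.
- have [s [sS sV]] := exists_perm_seg dSV.
  apply: Or32; exists s; apply: fintype.subset_trans (tr s) _.
  have := imset_Hset s F'H; rewrite HE sS sV St Vk.
  by rewrite (_ : t + (k - t).+1 = k.+1)%N//; lia.
- apply: Or33; apply: (@lt_le_trans _ _
    (rho R k (star_family k (seg n 1 t) (seg n t.+1 k.+1)))); last first.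
    by apply: rhoS; [lia|lia|rewrite HE; exact: star_sub_Hset].
  have Fk : kgraph k F.
    by have [F'k _ _] := F'nt => e eF; apply: F'k; exact: (fintype.subsetP FF').
  apply: (rho_cover_lt t0 tk kn Fk dSV St Vk st ss _ dSV0 St0 Vk0) => e eF.
  have [eS|eS] := boolP (e \in star_family k S V); [by left|right].
  exact: sF (fintype.subsetP FF' _ eF) eS.
Qed.

Lemma isomorphic_or_lt (F : {set {set 'I_n}}) : nontrivial_tintersecting k t F ->
  [\/ isomorphic F A, isomorphic F H
    | rho R k F < Num.max (rho R k A) (rho R k H)].
Proof.
move=> Fnt; have n0 : (0 < n)%N by lia. have k0 : (0 < k)%N by lia.
have sub (s : {perm 'I_n}) (G : {set {set 'I_n}}) :
    (forall E : {set {set 'I_n}}, E \subset G -> rho R k E = rho R k G -> E = G) ->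
    [set s @: e | e : {set 'I_n} in F]%SET \subset G ->
    isomorphic F G \/ rho R k F < rho R k G.
  move=> Gstrict FG.
  have iFs : isomorphic F [set s @: e | e : {set 'I_n} in F]%SET by exists s.
  have := rhoS (R := R) n0 k0 FG; rewrite -(rho_isomorphic (R := R) n0 k0 iFs).
  rewrite le_eqVlt => /predU1P[E|]; [left|by right].
  by exists s; apply: Gstrict => //; rewrite -(rho_isomorphic n0 k0 iFs).
have [[s FA]|[s FH]|FH] := sub_candidate_or_lt Fnt.
- have [|lt] := sub s _ Afam_strict FA; first exact: Or31.
  by apply: Or33; rewrite lt_max lt.
- have [|lt] := sub s _ Hfam_strict FH; first exact: Or32.
  by apply: Or33; rewrite lt_max lt orbT.
- by apply: Or33; rewrite lt_max FH orbT.
Qed.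

Lemma extremal_families :
  let M := Num.max (rho R k A) (rho R k H) in
  let extremal := fun F : {set {set 'I_n}} =>
    nontrivial_tintersecting k t F /\ rho R k F = M in
  [/\ forall F : {set {set 'I_n}}, nontrivial_tintersecting k t F ->
        rho R k F <= M /\
        (rho R k F = M <->
           (rho R k A = M /\ isomorphic F A) \/
           (rho R k H = M /\ isomorphic F H)),
      rho R k H < rho R k A ->
        forall F : {set {set 'I_n}}, extremal F <-> isomorphic F A,
      rho R k A < rho R k H ->
        forall F : {set {set 'I_n}}, extremal F <-> isomorphic F H
    & rho R k A = rho R k H ->
        forall F : {set {set 'I_n}},
          extremal F <-> isomorphic F A \/ isomorphic F H].
Proof.
move=> M extremal.
have n0 : (0 < n)%N by lia. have k0 : (0 < k)%N by lia.
have iA (F : {set {set 'I_n}}) : isomorphic F A -> rho R k F = rho R k A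
  by exact: rho_isomorphic.
have iH (F : {set {set 'I_n}}) : isomorphic F H -> rho R k F = rho R k H
  by exact: rho_isomorphic.
have AM : rho R k A <= M by rewrite le_max lexx.
have HM : rho R k H <= M by rewrite le_max lexx orbT.
have eA F : isomorphic F A -> rho R k A = M -> extremal F.
  move=> FA AE; split; last by rewrite iA.
  exact: nontrivial_isomorphic FA nontrivial_Afam.
have eH F : isomorphic F H -> rho R k H = M -> extremal F.
  move=> FH HE'; split; last by rewrite iH.
  exact: nontrivial_isomorphic FH nontrivial_Hfam.
have ext F : extremal F -> (rho R k A = M /\ isomorphic F A) \/
    (rho R k H = M /\ isomorphic F H).
  move=> [Fnt FM]; have [FA|FH|] := isomorphic_or_lt Fnt.
  - by left; split=> //; rewrite -(iA _ FA).
  - by right; split=> //; rewrite -(iH _ FH).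
  - by rewrite FM ltxx.
split.
- move=> F Fnt; split.
    by have [FA|FH|/ltW//] := isomorphic_or_lt Fnt; [rewrite (iA _ FA)|rewrite (iH _ FH)].
  split=> [FM|[[AE FA]|[HE' FH]]]; first exact: ext.
    by rewrite (iA _ FA).
  by rewrite (iH _ FH).
- move=> HA; have ME : M = rho R k A by rewrite /M max_l// ltW.
  move=> F; split=> [/ext[[]//|[HE' _]]|FA]; last exact: eA.
  by move: HA; rewrite HE' ME ltxx.
- move=> AH; have ME : M = rho R k H by rewrite /M max_r// ltW.
  move=> F; split=> [/ext[[AE _]|[]//]|FH]; last exact: eH.
  by move: AH; rewrite AE ME ltxx.
- move=> AH; have ME : M = rho R k H by rewrite /M AH maxxx.
  move=> F; split=> [/ext[[_ FA]|[_ FH]]|[FA|FH]]; [by left|by right| |].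
    by apply: eA => //; rewrite AH.
  exact: eH.
Qed.

End Extremality.

(** * The equation of kappa *)

(** The summand 1 is there for v = 3, where 9 = 2^3 + 1. *)
Lemma sqr_leq_exp2 v : (v ^ 2 <= (2 ^ v).+1)%N.
Proof.
have [|v4] := ltnP v 4; first by case: v => [|[|[|[|]]]].
apply: leqW; rewrite -(subnK v4); elim: (v - 4)%N => [//|j IH].
by rewrite addSn [leqRHS]expnS; move: IH; move: (2 ^ _)%N => N; rewrite -!mulnn; nia.
Qed.

Lemma logn_exp2_leq p a : (1 < a)%N -> (2 ^ logn p a <= a)%N.
Proof.
move=> a1; have [pp|npp] := boolP (prime p); last first.
  by rewrite lognE (negbTE npp) expn0; exact: ltnW.
apply: leq_trans (dvdn_leq (ltnW a1) (pfactor_dvdnn p a)).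
have [->|l0] := posnP (logn p a); first by rewrite !expn0.
by rewrite leq_exp2r// prime_gt1.
Qed.

(* Comparing exponents of a prime factor of t + 2 and of a prime factor of
   t + 1 shows that k - 1 divides the product of the two valuations. *)
Lemma kappa_nat_neq t k : (0 < t)%N -> (2 * t + 1 < k)%N ->
  (t.+2 ^ (k - t.+1) * t.+1 ^ t.+1)%N <> ((k - t).+1 ^ k.-1)%N.
Proof.
move=> t0 tk E.
pose p := pdiv t.+2; pose q := pdiv t.+1.
have pp : prime p by rewrite pdiv_prime.
have qp : prime q by rewrite pdiv_prime.
have co : coprime t.+1 t.+2 by exact: coprimenS.
have p1 : logn p t.+1 = 0%N.
  rewrite lognE pp/=; case: ifP => // pt.
  have : (p %| gcdn t.+1 t.+2)%N by rewrite dvdn_gcd pt pdiv_dvd.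
  by rewrite (eqP co) dvdn1 => /eqP p1; rewrite p1 in pp.
have q2 : logn q t.+2 = 0%N.
  rewrite lognE qp/=; case: ifP => // qt.
  have : (q %| gcdn t.+1 t.+2)%N by rewrite dvdn_gcd qt pdiv_dvd.
  by rewrite (eqP co) dvdn1 => /eqP q1; rewrite q1 in qp.
pose v := logn p t.+2; pose w := logn q t.+1.
have v0 : (0 < v)%N by rewrite logn_gt0 pi_pdiv.
have w0 : (0 < w)%N by rewrite logn_gt0 pi_pdiv.
have := congr1 (logn p) E; have := congr1 (logn q) E.
rewrite !lognM ?expn_gt0// !lognX p1 q2 !muln0 addn0 add0n -/v -/w => Ew Ev.
(* Here k - 1 divides (k - t - 1) v, and k - t - 1 is -t modulo k - 1. Together with [Dw] this makes
   k - 1 divide both t v w and (t + 1) v w, hence v w. *)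
have Dv : (k.-1 %| t * v)%N.
  have : (k.-1 %| (k - t.+1) * v)%N by rewrite Ev dvdn_mulr.
  move=> /dvdn_addr <-; rewrite -mulnDl (_ : _ + t = k.-1)%N ?dvdn_mulr//; lia.
have Dw : (k.-1 %| t.+1 * w)%N by rewrite Ew dvdn_mulr.
have D : (k.-1 %| v * w)%N.
  have : (k.-1 %| t * (v * w))%N by rewrite mulnA dvdn_mulr.
  move=> /dvdn_addr <-; rewrite -mulSnr mulnCA dvdn_mull//.
have vw : (k.-1 <= v * w)%N by apply: dvdn_leq => //; rewrite muln_gt0 v0.
have vt : (2 ^ v <= t.+2)%N by exact: logn_exp2_leq.
have wt : (2 ^ w <= t.+1)%N by exact: logn_exp2_leq.
have v2 := leq_trans (sqr_leq_exp2 v) (_ : (2 ^ v).+1 <= t.+3)%N.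
have w2 := leq_trans (sqr_leq_exp2 w) (_ : (2 ^ w).+1 <= t.+2)%N.
(* The valuations are logarithmic in t: v^2 <= t + 3 and w^2 <= t + 2 give v w <= t + 2 by AM-GM,
   below 2 t + 1 <= k - 1 once t >= 2. For t = 1 both valuations are at most 1. *)
have [t1|t2] := leqP t 1; last first.
  have [+ _] := nat_AGM2 v w; rewrite sqrnD.
  move: (v2 vt) (w2 wt) vw; move: (v ^ 2)%N (w ^ 2)%N (v * w)%N; move: tk t2; clear; lia.
have small u : (2 ^ u <= 3)%N -> (u <= 1)%N.
  by rewrite -ltnS (_ : 4 = 2 ^ 2)%N// ltn_exp2l.
have v1 := small v (leq_trans vt _); have w1 := small w (leq_trans wt _).
have := leq_trans vw (leq_mul (v1 _) (w1 _)).
by move: t1 tk t0; clear; lia.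
Qed.

Section Kappa.
Context {R : realType}.
Variable t : nat.
Hypothesis t0 : (0 < t)%N.

(* The logarithm of the quotient of the two sides of the equation of kappa. *)
Definition kappa_log (x : R) : R :=
  (x - t%:R - 1) * ln t.+2%:R + t.+1%:R * ln t.+1%:R
  - (x - 1) * ln (x - t%:R + 1).

(** The first summand changes sign at x - t + 1 = t + 2, that is at x = 2 t + 1, and decreases from
    there on; the second decreases throughout. *)
Lemma kappa_logE (x : R) : kappa_log x =
  (x - t%:R - 1) * (ln t.+2%:R - ln (x - t%:R + 1))
  + (t.+1%:R * ln t.+1%:R - t%:R * ln (x - t%:R + 1)).
Proof. by rewrite /kappa_log; ring. Qed.

Let t1R : 1 <= t%:R :> R. Proof. by rewrite ler1n. Qed.
Let tS1 : t.+1%:R = t%:R + 1 :> R. Proof. by rewrite -natr1. Qed.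
Let tS2 : t.+2%:R = t%:R + 2 :> R. Proof. by rewrite -natr1 -natr1; ring. Qed.

Lemma kappa_equationP (x : R) : t%:R + 1 < x ->
  kappa_equation t x <-> kappa_log x = 0.
Proof.
move=> tx; rewrite /kappa_equation !addn1 addn2.
have y0 : 0 < x - t%:R + 1 by lra.
have p1 : 0 < t.+1%:R ^+ t.+1 :> R by rewrite exprn_gt0.
have p2 : 0 < t.+2%:R `^ (x - t%:R - 1) :> R by rewrite powR_gt0.
have p3 : 0 < (x - t%:R + 1) `^ (x - 1) by rewrite powR_gt0.
have E : ln (t.+2%:R `^ (x - t%:R - 1) * t.+1%:R ^+ t.+1)
    - ln ((x - t%:R + 1) `^ (x - 1)) = kappa_log x.
  by rewrite lnM ?posrE// !ln_powR lnXn// /kappa_log [_ * ln t.+1%:R]mulr_natl.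
rewrite -E; split=> [->|/eqP]; first by rewrite subrr.
by rewrite subr_eq0 => /eqP /ln_inj; apply; rewrite posrE// mulr_gt0.
Qed.

Lemma kappa_log_const : 0 < t.+1%:R * ln t.+1%:R - t%:R * ln t.+2%:R :> R.
Proof.
have t1 := t1R.
(* with u = t + 1: ln (1 + 1/u) <= 1/u and - ln u = ln (1/u) < 1/u - 1 *)
set u : R := t.+1%:R.
have u2 : 2 <= u by rewrite /u tS1; lra.
have u0 : 0 < u by lra.
have E : ln t.+2%:R = ln u + ln (1 + u^-1).
  rewrite -lnM ?posrE ?addr_gt0 ?invr_gt0//; congr ln.
  by rewrite mulrDr mulr1 mulfV ?gt_eqF// /u tS1 tS2; ring.
have l1 : ln (1 + u^-1) <= u^-1.
  apply: le_ln1Dx; apply: lt_trans (_ : 0 < _); last by rewrite invr_gt0.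
  lra.
have l2 : 1 + - ln u < u^-1.
  have lnu : - ln u != 0 by rewrite oppr_eq0 ln_eq0// gt_eqF//; lra.
  by apply: lt_le_trans (expR_gt1Dx lnu) _; rewrite expRN lnK// posrE.
have tu : t%:R * u^-1 = 1 - u^-1.
  apply: (mulIf (_ : u != 0)); rewrite ?gt_eqF// mulfVK ?gt_eqF//.
  by rewrite mulrBl mulVf ?gt_eqF// mul1r /u tS1 addrK.
have : t%:R * ln (1 + u^-1) <= t%:R * u^-1 by rewrite ler_wpM2l ?ler0n.
rewrite E tu; have -> : u * ln u = t%:R * ln u + ln u by rewrite /u tS1; ring.
rewrite mulrDr; clearbody u; lra.
Qed.

(** Up to 2 t + 1 the first summand of [kappa_logE] is nonnegative, and the second is at least its
    value at 2 t + 1, which is positive by [kappa_log_const]. *)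
Lemma kappa_log_gt0 (x : R) : t%:R + 1 < x -> x <= 2 * t%:R + 1 -> 0 < kappa_log x.
Proof.
have t1 := t1R.
move=> x1 x2; rewrite kappa_logE; apply: ltr_wpDl.
  rewrite mulr_ge0//; first lra.
  by rewrite subr_ge0 ler_ln ?posrE ?tS2//; lra.
apply: lt_le_trans kappa_log_const _; rewrite lerD2l lerN2 ler_wpM2l ?ler0n//.
by rewrite ler_ln ?posrE ?tS2//; lra.
Qed.

Lemma kappa_log_decr (x x' : R) : 2 * t%:R + 1 <= x -> x < x' ->
  kappa_log x' < kappa_log x.
Proof.
have t1 := t1R.
move=> x1 xx'; rewrite !kappa_logE.
have lnlt : ln (x - t%:R + 1) < ln (x' - t%:R + 1).
  by rewrite ltr_ln ?posrE//; lra.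
have lnle : ln t.+2%:R <= ln (x - t%:R + 1).
  by rewrite ler_ln ?posrE ?tS2//; lra.
have H1 : (x - t%:R - 1) * (ln (x - t%:R + 1) - ln t.+2%:R)
    <= (x' - t%:R - 1) * (ln (x' - t%:R + 1) - ln t.+2%:R).
  by apply: ler_pM; lra.
have H2 : t%:R * ln (x - t%:R + 1) < t%:R * ln (x' - t%:R + 1).
  by rewrite ltr_pM2l//; lra.
lra.
Qed.

Lemma kappa_log_lt0 : exists2 b : R, 2 * t%:R + 1 <= b & kappa_log b < 0.
Proof.
have t1 := t1R.
(* At this point x - t + 1 = (t + 2)^2, so its logarithm is twice ln (t + 2) and everything compares
   with multiples of ln (t + 2). *)
pose b : R := t.+2%:R ^+ 2 + t%:R - 1.
have bE : b - t%:R + 1 = t.+2%:R ^+ 2 by rewrite /b; ring.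
exists b; first by rewrite /b tS2; nra.
have l0 : 0 < ln t.+2%:R :> R by rewrite ln_gt0// ltr1n.
have l12 : ln t.+1%:R <= ln t.+2%:R :> R by rewrite ler_ln ?posrE ?ltr0n// ler_nat.
rewrite kappa_logE bE lnXn// mulr2n.
have b2 : 0 < b - t%:R - 1 by rewrite /b tS2; nra.
have H1 : t.+1%:R * ln t.+1%:R <= t.+1%:R * ln t.+2%:R :> R by rewrite ler_wpM2l ?ler0n.
have H2 : 0 < (b - t%:R - 1) * ln t.+2%:R by rewrite mulr_gt0.
have H3 : 0 <= (t%:R - 1) * ln t.+2%:R :> R by rewrite mulr_ge0 ?subr_ge0 ?(ltW l0).
move: H1; rewrite tS1; lra.
Qed.

Lemma kappa_log_continuous (x : R) : t%:R + 1 < x -> {for x, continuous kappa_log}.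
Proof.
have t1 := t1R.
move=> tx.
have cln : {for x, continuous (fun z : R => ln (z - t%:R + 1))}.
  apply: (@continuous_comp _ _ _ (fun z : R => z - t%:R + 1) (@ln R)).
    by apply: cvgD; [apply: cvgB|]; [exact: cvg_id|exact: cvg_cst|exact: cvg_cst].
  by apply: continuous_ln; lra.
apply: cvgB; last first.
  by apply: cvgM; [apply: cvgB; [exact: cvg_id|exact: cvg_cst]|exact: cln].
apply: cvgD; last exact: cvg_cst.
by apply: cvgMl; apply: cvgB; [apply: cvgB; [exact: cvg_id|exact: cvg_cst]|exact: cvg_cst].
Qed.

Lemma kappa_exists : exists2 x : R, 2 * t%:R + 1 < x & kappa_log x = 0.
Proof.
have t1 := t1R.
have [b tb kb] := kappa_log_lt0.
have ka : 0 < kappa_log (2 * t%:R + 1) by apply: kappa_log_gt0; lra.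
have [|||x xab kx] := @IVT R kappa_log (2 * t%:R + 1) b 0.
- exact: tb.
- apply: continuous_in_subspaceT => x; rewrite inE/= in_itv/= => /andP[xa _].
  by apply: kappa_log_continuous; lra.
- by rewrite ge_min le_max (ltW kb) (ltW ka) orbT.
exists x => //; move: xab; rewrite in_itv/= le_eqVlt => /andP[/predU1P[xE|//] _].
by move: ka; rewrite xE kx !ltxx.
Qed.

Lemma kappa_log_sign (x kappa : R) : 2 * t%:R + 1 < kappa -> kappa_log kappa = 0 ->
  t%:R + 1 < x -> (0 < kappa_log x) = (x < kappa) /\ (kappa_log x < 0) = (kappa < x).
Proof.
have t1 := t1R.
move=> tk kk tx.
have [xk|xk|->] := ltgtP x kappa.
- have [x1|x1] := leP x (2 * t%:R + 1).
    by have := kappa_log_gt0 tx x1 => h; rewrite h ltNge (ltW h).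
  by have := kappa_log_decr (ltW x1) xk; rewrite kk => h; rewrite h ltNge (ltW h).
- by have := kappa_log_decr (ltW tk) xk; rewrite kk => h; rewrite h ltNge (ltW h).
- by rewrite kk ltxx.
Qed.

Lemma kappa_not_int (kappa : R) : 2 * t%:R + 1 < kappa -> kappa_log kappa = 0 ->
  kappa \isn't a Num.int.
Proof.
have t1 := t1R.
move=> tk /(kappa_equationP (_ : t%:R + 1 < kappa)) => /(_ ltac:(lra)) ke.
apply/negP => ki.
have : kappa \is a Num.nat by rewrite natrEint ki; lra.
move=> /natrP[k kE]; move: tk; rewrite kE -natrM natr1 ltr_nat => tk.
apply: (@kappa_nat_neq t k t0); first lia.
apply/eqP; rewrite -(eqr_nat R) natrM !natrX; apply/eqP.
have tk' : (t <= k)%N by lia.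
move: ke; rewrite /kappa_equation kE !addn1 addn2.
have -> : k%:R - t%:R - 1 = (k - t.+1)%:R :> R.
  by rewrite natrB ?tS1; [ring|lia].
have -> : k%:R - t%:R + 1 = (k - t).+1%:R :> R by rewrite -natr1 natrB.
have -> : k%:R - 1 = k.-1%:R :> R.
  by rewrite -subn1 natrB//; lia.
by rewrite !powR_mulrn.
Qed.

End Kappa.

(** * Asymptotics *)

Section HsetCover.
Import mathcomp.boot.fintype mathcomp.boot.finset.
Context {n : nat}.
Variables (k t : nat) (S V : {set 'I_n}).
Hypotheses (dSV : [disjoint S & V]) (St : #|S| = t) (Vk : #|V| = (k - t).+1).
Hypothesis tk : (t.+1 < k)%N.

(** An edge of H outside the star family has at least t + 2 elements in S + V. Taking all
    (t+2)-subsets of S + V is wasteful, but their number does not depend on n, which is enough for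
    the limit. *)
Lemma covered_Hset :
  covered (Hset k S V) t.+2 'C(k.+1, t.+2) (fun e => e \notin star_family k S V).
Proof.
have SVk := card_SV dSV St Vk tk.
exists (enum [set U : {set 'I_n} | U \subset S :|: V & #|U| == t.+2]); split.
- by rewrite -cardE cards_draws SVk.
- by move=> U; rewrite mem_enum inE => /andP[_ /eqP].
move=> e eH eS.
suff /exists_subset_card[U Ue Ut] : (t.+1 < #|e :&: (S :|: V)|)%N.
  move: Ue; rewrite subsetI => /andP[Ue US].
  by exists U; rewrite // mem_enum inE US Ut eqxx.
move: (eH); rewrite in_setU => /orP[|/imsetP[j jS ->]]; last first.
  rewrite setIC (setIidPr (subD1set _ _)).
  by have := cardsD1 j (S :|: V); rewrite SVk in_setU jS; lia.
rewrite inE => /and3P[ek Se /set0Pn[v]]; rewrite in_setI => /andP[ve vV].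
have vS : v \notin S by rewrite (disjointFl dSV vV).
have vSe : v |: S \subset e :&: (S :|: V).
  by rewrite subUset sub1set !in_setI in_setU ve vV orbT subsetI Se subsetUl.
have := subset_leq_card vSe; rewrite cardsU1 vS St leq_eqVlt => /predU1P[E|//].
case/negP: eS; rewrite inE ek; apply/imsetP; exists v => //.
by apply/esym/eqP; rewrite eqEcard vSe cardsU1 vS St E leqnn.
Qed.

End HsetCover.

Section Limits.
Local Open Scope classical_set_scope.
Context {R : realType}.
Variables (k t : nat).
Hypothesis tk : (t.+1 < k)%N.
Local Notation m := (k - t.+1)%N.
Local Notation g n := (gauge k m m n : R).

(** The k-th power of rtq k n is n^(k-1) >= n, which exceeds every fixed bound. *)
Lemma cvg_rtqV : (rtq k n%:R)^-1 @[n --> \oo] --> (0 : R).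
Proof.
have q0 n : (0 < n)%N -> 0 < rtq k n%:R :> R by move=> ?; rewrite rtq_gt0 ?ltr0n.
apply/gtr0_cvgV0; first by near=> n; apply: q0; near: n; exact: nbhs_infty_gt.
apply/cvgryPgt => A.
pose B := Num.max A 1.
near=> n.
have n0 : (0 < n)%N by near: n; exact: nbhs_infty_gt.
apply: (@le_lt_trans _ _ B); first by rewrite le_max lexx.
have B0 : 0 <= B by rewrite le_max ler01 orbT.
rewrite -(@ltr_pXn2r _ k) ?nnegrE ?(ltW (q0 _ n0))//; last lia.
rewrite rtqX ?ltr0n//; last lia.
apply: (@lt_le_trans _ _ n%:R).
  by near: n; exact: nbhs_infty_gtr.
by rewrite -natrX ler_nat -{1}(expn1 n) leq_pexp2l//; lia.
Unshelve. all: by end_near. Qed.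

Lemma cvg_one_sub c j : (1 - c / n%:R) ^+ j @[n --> \oo] --> (1 : R).
Proof.
have cn : 1 - c / n%:R @[n --> \oo] --> (1 - c * 0 : R).
  apply: cvgB; first exact: cvg_cst.
  apply: cvgM; first exact: cvg_cst.
  apply/gtr0_cvgV0; last exact: cvgr_idn.
  by near=> n; rewrite ltr0n; near: n; exact: nbhs_infty_gt.
have := @cvg_comp _ _ _ (fun n : nat => 1 - c / n%:R) (fun z : R => z ^+ j) _ _ _ cn.
rewrite mulr0 subr0 => /(_ _ (@exprn_continuous R j 1)); rewrite expr1n; exact.
Unshelve. all: by end_near. Qed.

Lemma cvg_normalized (r : nat -> R) (lam c : R) (L : nat) :
  (\forall n \near \oo, lam * g n * (1 - c / n%:R) ^+ m <= r n
     <= (lam + L%:R / rtq k n%:R) * g n) ->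
  r n / g n @[n --> \oo] --> lam.
Proof.
move=> H.
apply: (@squeeze_cvgr _ _ _ _ (fun n => lam * (1 - c / n%:R) ^+ m)
  (fun n => lam + L%:R * (rtq k n%:R)^-1)).
- near=> n.
  have g0 : 0 < g n.
    by apply: gauge_gt0; [lia|near: n; exact: nbhs_infty_gt].
  have /andP[lo up] : lam * g n * (1 - c / n%:R) ^+ m <= r n
     <= (lam + L%:R / rtq k n%:R) * g n by near: n.
  by rewrite ler_pdivlMr// mulrAC lo ler_pdivrMr.
- rewrite -[X in _ --> X]mulr1; apply: cvgM; first exact: cvg_cst.
  exact: cvg_one_sub.
- rewrite -[X in _ --> X]addr0 -[X in _ --> lam + X](mulr0 L%:R).
  apply: cvgD; first exact: cvg_cst.
  by apply: cvgM; [exact: cvg_cst|exact: cvg_rtqV].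
Unshelve. all: by end_near. Qed.

(** An edge of A has t + 1 elements in Y = [t + 2], and is then in the near family, or contains Y.
    The second kind is one [up_family], hence the error constant k - t - 1. *)
Lemma cvg_rho_Afam : rho R k (Afam n k t) / g n @[n --> \oo] --> near_weight k t.
Proof.
apply: (@cvg_normalized _ _ (2 * k)%:R m); near=> n.
have kn : (3 * k <= n)%N by near: n; exact: nbhs_infty_ge.
have Y2 : #|seg n 1 t.+2| = t.+2 by have [|//] := @card_seg n t.+2 0; lia.
have k0 : (0 < k)%N by lia. have n0 : (0 < n)%N by lia.
have Ak : kgraph k (Afam n k t) by exact: kgraph_Aset.
apply/andP; split.
  apply: le_trans (rho_near_family_ge Y2 tk _) _; first lia.
  apply: rhoS => //; apply/fintype.subsetP => e.
  rewrite AfamE !finset.inE => /andP[-> /finset.imsetP[j jY ->]] /=.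
  by have := finset.cardsD1 j (seg n 1 t.+2); rewrite Y2 jY add1n => -[<-].
apply: rho_le => // x x0 xk.
have := @edge_poly_cover R n k _ (near_family k (seg n 1 t.+2)) [:: seg n 1 t.+2] x Ak x0.
rewrite big_seq1 => /(_ _) H.
apply: (@le_trans _ _ (k%:R * (edge_poly (near_family k (seg n 1 t.+2)) x +
  edge_poly (up_family k (seg n 1 t.+2)) x))).
  rewrite ler_wpM2l ?ler0n//; apply: H => e.
  rewrite AfamE finset.inE => /andP[ek]; rewrite leq_eqVlt => /predU1P[E|Ylt].
    left; rewrite finset.inE ek/=; set Y := seg n 1 t.+2 in Y2 E *.
    have /cards1P[j jE] : #|Y :\: e|%SET == 1%N.
      by rewrite finset.cardsD finset.setIC -E Y2 subSnn.
    have jY : j \in Y by have := finset.set11 j; rewrite -jE finset.inE => /andP[].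
    apply/finset.imsetP; exists j => //; rewrite -jE finset.setDDr finset.setDv finset.set0U.
    exact: finset.setIC.
  right; exists (seg n 1 t.+2); first by rewrite inE.
  apply/finset.setIidPr/eqP; rewrite finset.eqEcard finset.subsetIr Y2; exact: Ylt.
rewrite mulrDr mulrDl; apply: lerD.
  by have := near_family_le Y2 tk (_ : (k < n)%N) x0; rewrite xk mulr1; apply; lia.
have := up_family_le Y2 tk (_ : (k < n)%N) x0; rewrite xk mulr1 => /(_ _) U.
apply: le_trans (U _) _; first lia.
have := @gauge_pred R n k m n0; rewrite -subnS mulrC; apply; lia.
Unshelve. all: by end_near. Qed.

Lemma cvg_rho_Hfam : rho R k (Hfam n k t) / g n @[n --> \oo] --> rtq k (k - t).+1%:R.
Proof.
apply: (@cvg_normalized _ _ (2 * k)%:R ('C(k.+1, t.+2) * m)); near=> n.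
have kn : (3 * k <= n)%N by near: n; exact: nbhs_infty_ge.
have [|St Vt] := @card_seg n t (k - t).+1; first lia.
have tkE : (t + (k - t).+1 = k.+1)%N by lia.
rewrite tkE in Vt.
have dSV := @disjoint_seg n t k.+1.
rewrite HfamE; last lia.
apply/andP; split.
  have := @rho_star_family_ge R n k t _ _ dSV St tk.
  rewrite Vt => /(_ _ _ _) lo; apply: le_trans (lo _ _ _) _; [by []|lia|lia|].
  by apply: rhoS; [lia|lia|exact: star_sub_Hset].
apply: rho_le; [lia|lia|move=> x x0 xk].
have [s [ss st sF]] := covered_Hset dSV St Vt tk.
have := @cover_le R n k t _ _ (Hset k (seg n 1 t) (seg n t.+1 k.+1)) s x
  (kgraph_Hset dSV St Vt tk) dSV St tk _ _ x0 st _.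
rewrite Vt xk mulr1 => /(_ _ _ _) up; apply: le_trans (up _ _ _) _; [lia|lia| |].
  move=> e eH; have [eS|eS] := boolP (e \in star_family k (seg n 1 t) (seg n t.+1 k.+1)).
    by left.
  by right; exact: sF.
have g0 : 0 < g n by apply: gauge_gt0; lia.
rewrite ler_pM2r// lerD2l ler_wpM2r ?invr_ge0 ?rtq_ge0//.
by rewrite ler_nat leq_mul2r ss orbT.
Unshelve. all: by end_near. Qed.

Lemma asymptotic_ratio_cvg :
  asymptotic_ratio k t (near_weight k t / rtq k (k - t).+1%:R : R).
Proof.
have p0 : rtq k (k - t).+1%:R != 0 :> R by rewrite gt_eqF// rtq_gt0 ?ltr0n.
have H := cvgM cvg_rho_Afam (cvgV p0 cvg_rho_Hfam).
(* The gauge cancels in the quotient where it is nonzero, hence for all n > 0. *)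
suff E : {near \oo,
    (fun n => rho R k (Afam n k t) / g n * (rho R k (Hfam n k t) / g n)^-1)
    =1 (fun n => rho R k (Afam n k t) / rho R k (Hfam n k t))}.
  by rewrite /asymptotic_ratio; apply: (cvg_trans (near_eq_cvg E)); exact: H.
near=> n.
have g0 : g n != 0.
  by rewrite gt_eqF// gauge_gt0//; [lia|near: n; exact: nbhs_infty_gt].
move: (rho R k (Afam n k t)) (rho R k (Hfam n k t)) (g n) g0 => a h w w0.
by rewrite invfM invrK mulrACA mulVf ?mulr1.
Unshelve. all: by end_near. Qed.

Lemma ln_asymptotic_ratio :
  k%:R * ln (near_weight k t / rtq k (k - t).+1%:R : R) = kappa_log t k%:R.
Proof.
have k0 : k%:R != 0 :> R by rewrite pnatr_eq0; lia.
have r0 : 0 < t.+1%:R / t.+2%:R :> R by rewrite divr_gt0 ?ltr0n.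
have p0 : 0 < (k - t).+1%:R :> R by rewrite ltr0n.
have q0 : 0 < rtq k (k - t).+1%:R :> R by rewrite rtq_gt0.
have rr0 : 0 < rt k (t.+1%:R / t.+2%:R) ^+ t.+1 :> R by rewrite exprn_gt0// rt_gt0.
have t20 : 0 < t.+2%:R :> R by rewrite ltr0n.
have nw0 : 0 < near_weight k t :> R by rewrite mulr_gt0.
rewrite ln_div ?posrE// /near_weight lnM ?posrE//.
rewrite lnXn ?rt_gt0// ln_powR ln_div ?posrE ?ltr0n//.
rewrite /rtq ln_div ?posrE ?rt_gt0// ln_powR.
rewrite /kappa_log.
have -> : k%:R - t%:R + 1 = (k - t).+1%:R :> R by rewrite -natr1 natrB//; lia.
rewrite -[_ *+ t.+1]mulr_natl.
rewrite -[in t.+1%:R * (_ * _)]natr1 -[in t.+1%:R * ln t.+1%:R]natr1.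
by field.
Qed.

Lemma asymptotic_ratio_sign :
  (1 < near_weight k t / rtq k (k - t).+1%:R :> R) = (0 < kappa_log t k%:R :> R)
  /\ (near_weight k t / rtq k (k - t).+1%:R < 1 :> R) = (kappa_log t k%:R < 0 :> R).
Proof.
rewrite -ln_asymptotic_ratio.
have k0 : 0 < k%:R :> R by rewrite ltr0n; lia.
have l0 : 0 < near_weight k t / rtq k (k - t).+1%:R :> R.
  by rewrite divr_gt0 ?rtq_gt0 ?ltr0n// mulr_gt0 ?exprn_gt0 ?rt_gt0 ?divr_gt0 ?ltr0n.
rewrite pmulr_rgt0// pmulr_rlt0// -(ln1 R) !ltr_ln ?posrE//.
Qed.

End Limits.

Theorem theorem1p7 (R : realType) :
  (forall k t n : nat,
     (1 <= t)%N -> (t + 2 <= k)%N -> (100 * 2 ^ k * k ^ 7 <= n)%N ->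
     let A := Afam n k t in
     let H := Hfam n k t in
     let M := Num.max (rho R k A) (rho R k H) in
     let extremal := fun F : {set {set 'I_n}} =>
       nontrivial_tintersecting k t F /\ rho R k F = M in
     [/\ forall F : {set {set 'I_n}}, nontrivial_tintersecting k t F ->
           rho R k F <= M /\
           (rho R k F = M <->
              (rho R k A = M /\ isomorphic F A) \/
              (rho R k H = M /\ isomorphic F H)),
         rho R k H < rho R k A ->
           forall F : {set {set 'I_n}}, extremal F <-> isomorphic F A,
         rho R k A < rho R k H ->
           forall F : {set {set 'I_n}}, extremal F <-> isomorphic F H
       & rho R k A = rho R k H ->
           forall F : {set {set 'I_n}},
             extremal F <-> isomorphic F A \/ isomorphic F H])
  /\
  (forall t : nat, (1 <= t)%N ->
     exists kappa : R,
       [/\ t%:R + 1 < kappa /\ kappa_equation t kappa,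
           forall x : R, t%:R + 1 < x -> kappa_equation t x -> x = kappa,
           kappa \isn't a Num.int,
           forall k : nat, (t + 2 <= k)%N -> k%:Z <= Num.floor kappa ->
             exists2 l : R, asymptotic_ratio k t l & 1 < l
         & forall k : nat, Num.ceil kappa <= k%:Z ->
             exists2 l : R, asymptotic_ratio k t l & l < 1]).
Proof.
split=> [k t n t0 tk kn A H M extremal|t t0].
  by apply: extremal_families => //; rewrite -addn2.
have [kappa tkappa kappa0] := kappa_exists (R := R) t0.
have t1 : 1 <= t%:R :> R by rewrite ler1n.
have tkappa' : t%:R + 1 < kappa by lra.
have kappaNint := kappa_not_int t0 tkappa kappa0.
have sign x tx := kappa_log_sign t0 tkappa kappa0 (x := x) tx.
exists kappa; split => //.
- by split=> //; apply/kappa_equationP.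
- move=> x tx /(kappa_equationP tx) x0; have [s1 s2] := sign x tx.
  by apply/le_anti; rewrite !leNgt -s1 -s2 x0 ltxx.
- move=> k tk kf; have tk' : (t.+1 < k)%N by rewrite -addn2.
  exists (near_weight k t / rtq k (k - t).+1%:R).
    exact: asymptotic_ratio_cvg.
  have tx : t%:R + 1 < k%:R :> R by rewrite natr1 ltr_nat.
  (* The bound k <= floor kappa gives only k <= kappa; equality is excluded because kappa is not an
     integer. *)
  rewrite (asymptotic_ratio_sign tk').1 (sign _ tx).1 lt_neqAle.
  rewrite floor_ge_int in kf.
  rewrite kf andbT; apply: contraNneq kappaNint => <-.
  exact: natr_int.
- move=> k kc; have kk : kappa <= k%:R.
    by rewrite ceil_le_int in kc.
  have tx : t%:R + 1 < k%:R :> R by exact: lt_le_trans kk.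
  have tk' : (t.+1 < k)%N by move: tx; rewrite natr1 ltr_nat.
  exists (near_weight k t / rtq k (k - t).+1%:R).
    exact: asymptotic_ratio_cvg.
  rewrite (asymptotic_ratio_sign tk').2 (sign _ tx).2 lt_neqAle kk andbT.
  by apply: contraNneq kappaNint => ->; exact: natr_int.
Qed.
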